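(* Let $(M_i,g_i)$, $i=1,2$, be connected Riemannian manifolds. Assume that the gradient of $f_1$ is parallel with respect to $\nabla^1$. If $(M_1\times M_2,h_{f_1f_2})$ is flat, then the base $(M_1,g_1)$ is flat and the fiber $(M_2,g_2)$ is a space of constant sectional curvature, its sectional curvature being $$k=\frac{b_1}{1+(cf_2)^2b_1}.$$
   Context: $\pi_i:M_1\times M_2\to M_i$ are the projections; $\varphi_1^h=\varphi_1\circ\pi_1$, $\varphi_2^v=\varphi_2\circ\pi_2$ for functions $\varphi_i$ on $M_i$. $c\in\mathbb R$ is arbitrary, $f_i:M_i\to(0,\infty)$ is smooth, and $$h_{f_1f_2}=\pi_1^*g_1+(f_1^h)^2\pi_2^*g_2+\frac{c^2}{2}(f_2^v)^2\,df_1^h\odot df_1^h,\qquad \alpha\odot\beta=\alpha\otimes\beta+\beta\otimes\alpha,$$ a Riemannian metric on $M_1\times M_2$. $\nabla^1$ is the Levi-Civita connection of $g_1$, $\mathrm{grad} f_1$ is the $g_1$-gradient, and $b_1=g_1(\mathrm{grad} f_1,\mathrm{grad} f_1)$, a constant since $\mathrm{grad} f_1$ is parallel and $M_1$ is connected. The sectional curvature statement concerns the tangent 2-planes of $M_2$ (it is vacuous if $\dim M_2=1$). *)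

(* Defs.v *)
From HB Require Import structures.
From mathcomp Require Import all_boot all_order all_algebra.
From mathcomp Require Import all_classical all_reals all_analysis.
From mathcomp Require Import ring.
Set Implicit Arguments.
Unset Strict Implicit.
Unset Printing Implicit Defensive.
Import Order.TTheory GRing.Theory Num.Theory.
Import numFieldNormedType.Exports.
Local Open Scope classical_set_scope.
Local Open Scope ring_scope.

(** C^k and C^oo maps on an open set [U] of a normed space. *)

Section smooth.
Variables (R : realType) (V W : normedModType R).

Fixpoint Ck (k : nat) (U : set V) (f : V -> W) : Prop :=
  if k is k'.+1 then
    (forall x, U x -> differentiable f x) /\
    (forall v, Ck k' U (fun x => 'D_v f x))
  else forall x, U x -> {for x, continuous f}.

Definition smooth_on (U : set V) (f : V -> W) := forall k, Ck k U f.

End smooth.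

Section smooth_theory.
Variable R : realType.

Lemma near_eq_differentiable (V W : normedModType R) (f g : V -> W) (x : V) :
  (\near x, f x = g x) -> differentiable f x -> differentiable g x.
Proof.
move=> fg df.
have -> : g = f \+ (g \- f) by apply/funext => y /=; rewrite addrC subrK.
apply: differentiableD => //.
have h0 : \forall y \near x, (g \- f) y = 0.
  by apply: filterS fg => y /= ->; rewrite subrr.
set h := g \- f in h0 *.
have hE : h \o shift x = cst (h x) + (\0 : V -> W) +o_ 0 id.
  apply/eqaddoP => _/posnumP[e].
  have h0' : \forall y \near (0 : V), h (y + x) = 0.
    by move: h0; rewrite (near_shift 0) subr0.
  apply: filterS h0' => y /= hy.
  rewrite /GRing.opp /= /GRing.add /= hy (nbhs_singleton h0) addr0 subrr normr0.
  by rewrite mulr_ge0.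
have c0 : continuous (\0 : V -> W) by move=> y; exact: cvg_cst.
have dE : 'd h x = (\0 : V -> W) :> (V -> W) by exact: diff_unique c0 hE.
by apply/diff_locallyP; rewrite dE; split.
Qed.

Lemma Ck_eq (V W : normedModType R) k (U : set V) (f g : V -> W) :
  open U -> (forall x, U x -> f x = g x) -> Ck k U f -> Ck k U g.
Proof.
move=> oU; have nU x : U x -> \forall y \near x, U y.
  by move=> Ux; exact: open_nbhs_nbhs.
elim: k f g => [|k IH] f g fg /=.
  move=> cf x Ux.
  have := cf x Ux; rewrite /prop_for /continuous_at fg //; apply: cvg_trans.
  apply: near_eq_cvg.
  by apply: filterS (nU _ Ux) => y /fg.
move=> [df Cf]; split=> [x Ux|v].
  apply: near_eq_differentiable (df x Ux).
  by apply: filterS (nU _ Ux) => y /fg.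
apply: IH (Cf v) => x Ux; apply: near_eq_derive.
by apply: filterS (nU _ Ux) => y /fg.
Qed.

Lemma Ck_sub (V W : normedModType R) k (U U' : set V) (f : V -> W) :
  U' `<=` U -> Ck k U f -> Ck k U' f.
Proof.
move=> sU; elim: k f => [|k IH] f /=; first by move=> cf x /sU /cf.
by move=> [df Cf]; split=> [x /sU /df|v] //; exact: IH.
Qed.

Lemma CkD (V W : normedModType R) k (U : set V) (f g : V -> W) :
  open U -> Ck k U f -> Ck k U g -> Ck k U (f \+ g).
Proof.
move=> oU; elim: k f g => [|k IH] f g /=.
  by move=> cf cg x Ux; apply: cvgD; [exact: cf|exact: cg].
move=> [df Cf] [dg Cg]; split=> [x Ux|v].
  by apply: differentiableD; [exact: df|exact: dg].
apply: (Ck_eq oU _ (IH _ _ (Cf v) (Cg v))) => x Ux /=.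
by rewrite deriveD //; apply: diff_derivable; [exact: df|exact: dg].
Qed.

Lemma Ck_lin (V V' W W' : normedModType R) k (U : set V) (f : V -> W)
    (L : {linear V' -> V}) (B : {linear W -> W'}) :
  continuous L -> continuous B -> open U ->
  Ck k U f -> Ck k (L @^-1` U) (B \o f \o L).
Proof.
move=> cL cB oU.
have oLU : open (L @^-1` U) by apply: open_comp.
elim: k f => [|k IH] f /=.
  move=> cf x Ux; apply: continuous_comp; first exact: cL.
  by apply: continuous_comp; [exact: cf|exact: cB].
move=> [df Cf].
have dL x : differentiable L x by exact: linear_differentiable.
have dB x : differentiable B x by exact: linear_differentiable.
have dfL x : U (L x) -> differentiable (f \o L) x.
  by move=> Ux; apply: differentiable_comp => //; exact: df.
have dBfL x : U (L x) -> differentiable (B \o f \o L) x.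
  by move=> Ux; apply: (@differentiable_comp _ _ _ _ (f \o L) B) => //; exact: dfL.
split=> [x Ux|v]; first exact: dBfL.
apply: (Ck_eq oLU _ (IH _ (Cf (L v)))) => x Ux /=.
rewrite [RHS]deriveE; last exact: dBfL.
rewrite (@diff_comp _ _ _ _ (f \o L) B) //=; last exact: dfL.
rewrite (@diff_comp _ _ _ _ L f) //=; last exact: df.
by rewrite !diff_lin // deriveE //; exact: df.
Qed.

Lemma continuous_row_mx (T : topologicalType) n1 n2
    (f : T -> 'rV[R]_n1) (g : T -> 'rV[R]_n2) (x : T) :
  {for x, continuous f} -> {for x, continuous g} ->
  {for x, continuous (fun y => row_mx (f y) (g y))}.
Proof.
move=> cf cg; rewrite /continuous_at.
have coordN n (h : T -> 'rV[R]_n) i j (A : set R) : {for x, continuous h} ->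
    nbhs (h x i j) A -> \forall y \near x, A (h y i j).
  move=> ch hA.
  have /(_ A hA) := cvg_comp _ _ ch (@coord_continuous R 1 n i j (h x)).
  exact.
move=> A [P nP sPA]; apply: filterS (_ : \forall y \near x, forall i j,
   P i j (row_mx (f y) (g y) i j)).
  by move=> y Py; apply: sPA.
apply: filter_forall => i; apply: filter_forall => j.
have := nP i j; rewrite -(splitK j); case: (fintype.split j) => k /=.
  by rewrite row_mxEl => /(coordN _ _ _ _ _ cf); apply: filterS => y;
     rewrite row_mxEl.
by rewrite row_mxEr => /(coordN _ _ _ _ _ cg); apply: filterS => y;
   rewrite row_mxEr.
Qed.

End smooth_theory.

(** Smooth manifolds modelled on ['rV[R]_n], given by an atlas indexed by
    [chart].  [cinv i] inverts [coords i] on [coords i @` dom i] and is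
    arbitrary outside. *)

Record manifold (R : realType) (n : nat) := Manifold {
  carrier :> topologicalType;
  chart : Type;
  dom : chart -> set carrier;
  coords : chart -> carrier -> 'rV[R]_n;
  cinv : chart -> 'rV[R]_n -> carrier;
  man_nonempty : [set: carrier] !=set0;
  man_hausdorff : hausdorff_space carrier;
  man_second_countable : @second_countable carrier;
  man_cover : forall p, exists i, dom i p;
  dom_open : forall i, open (dom i);
  cod_open : forall i, open (coords i @` dom i);
  coordsK : forall i p, dom i p -> cinv i (coords i p) = p;
  coords_cont : forall i p, dom i p -> {for p, continuous (coords i)};
  cinv_cont : forall i x, (coords i @` dom i) x -> {for x, continuous (cinv i)};
  transition_smooth : forall i j,
    smooth_on (coords i @` (dom i `&` dom j)) (coords j \o cinv i)
}.

Lemma open_overlap (R : realType) (n : nat) (M : manifold R n) (i j : chart M) :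
  open (coords i @` (dom i `&` dom j)).
Proof.
have -> : coords i @` (dom i `&` dom j) =
    (coords i @` dom i) `&` (cinv i @^-1` dom j).
  apply/seteqP; split=> x.
    by move=> [p [ip jp] <-]; split; [exists p|rewrite /= coordsK].
  by move=> [[p ip <-]] /=; rewrite coordsK // => jp; exists p.
rewrite openE => x [ix jx]; apply: filterI.
  by apply: open_nbhs_nbhs; split=> //; exact: cod_open.
have /(_ (dom j)) := cinv_cont ix; apply.
by apply: open_nbhs_nbhs; split=> //; exact: dom_open.
Qed.

Section product.
Variables (R : realType) (n1 n2 : nat) (M1 : manifold R n1) (M2 : manifold R n2).

Local Notation M := (M1 * M2)%type.
Definition prod_dom (i : chart M1 * chart M2) : set M := dom i.1 `*` dom i.2.
Definition prod_coords (i : chart M1 * chart M2) (p : M) : 'rV[R]_(n1 + n2) :=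
  row_mx (coords i.1 p.1) (coords i.2 p.2).
Definition prod_cinv (i : chart M1 * chart M2) (x : 'rV[R]_(n1 + n2)) : M :=
  (cinv i.1 (lsubmx x), cinv i.2 (rsubmx x)).

Lemma prod_nonempty : [set: M] !=set0.
Proof.
by have [p _] := man_nonempty M1; have [q _] := man_nonempty M2; exists (p, q).
Qed.

Lemma nbhsX (p : M1) (q : M2) (A : set M1) (B : set M2) :
  nbhs p A -> nbhs q B -> nbhs (p, q) (A `*` B).
Proof. by move=> nA nB; exists (A, B). Qed.

Lemma prod_hausdorff : hausdorff_space M.
Proof.
move=> [p1 p2] [q1 q2] pq; congr (_, _); apply: man_hausdorff => A B nA nB.
  have [|//|[x1 x2] [[/= Ax _] [/= Bx _]]] := pq (A `*` setT) (B `*` setT).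
  - exact: nbhsX nA filterT.
  - exact: nbhsX nB filterT.
  - by exists x1.
have [|//|[x1 x2] [[/= _ Ax] [/= _ Bx]]] := pq (setT `*` A) (setT `*` B).
- exact: nbhsX filterT nA.
- exact: nbhsX filterT nB.
- by exists x2.
Qed.

Lemma openX (A : set M1) (B : set M2) : open A -> open B -> open (A `*` B).
Proof.
rewrite !openE => oA oB [p q] [/= Ap Bq].
by apply: nbhsX; [exact: oA|exact: oB].
Qed.

Lemma prod_second_countable : @second_countable M.
Proof.
have [B1 cB1 [oB1 bB1]] := man_second_countable M1.
have [B2 cB2 [oB2 bB2]] := man_second_countable M2.
exists ((fun AB : set M1 * set M2 => AB.1 `*` AB.2) @` (B1 `*` B2)).
  by apply: sub_countable (card_image_le _ _) _; exact: countableX.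
split=> [_ [[A B] [/= /oB1 oA /oB2 oB] <-]|[p q] C [[A B] [/= nA nB] sAB]].
  exact: openX.
have [A' /= [BA' A'p] sA] := bB1 _ _ nA.
have [B' /= [BB' B'q] sB] := bB2 _ _ nB.
exists (A' `*` B') => /=; first by split=> //; exists (A', B').
by move=> [x y] [/= /sA Ax /sB By]; apply: sAB.
Qed.

Lemma prod_cover p : exists i, prod_dom i p.
Proof.
by have [i ip] := man_cover p.1; have [j jp] := man_cover p.2; exists (i, j).
Qed.

Lemma prod_dom_open i : open (prod_dom i).
Proof. by apply: openX; exact: dom_open. Qed.

Lemma prod_codE i (A : set M1) (B : set M2) :
  prod_coords i @` (A `*` B) =
  (lsubmx @^-1` (coords i.1 @` A)) `&` (rsubmx @^-1` (coords i.2 @` B)).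
Proof.
apply/seteqP; split=> x.
  move=> [[p q] [/= Ap Bq] <-]; split; rewrite /= /prod_coords ?row_mxKl ?row_mxKr.
    by exists p.
  by exists q.
move=> [[p Ap px] [q Bq qx]]; exists (p, q) => //=.
by rewrite /prod_coords /= px qx hsubmxK.
Qed.

Lemma open_block (A : set 'rV[R]_n1) (B : set 'rV[R]_n2) : open A -> open B ->
  open ((lsubmx @^-1` A) `&` (rsubmx @^-1` B) : set 'rV[R]_(n1 + n2)).
Proof.
move=> oA oB; apply: openI; apply: open_comp => // x _.
  exact: continuous_lsubmx.
exact: continuous_rsubmx.
Qed.

Lemma prod_cod_open i : open (prod_coords i @` prod_dom i).
Proof. by rewrite prod_codE; apply: open_block; exact: cod_open. Qed.

Lemma prod_coordsK i p : prod_dom i p -> prod_cinv i (prod_coords i p) = p.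
Proof.
case: p => p q [/= ip jq].
by rewrite /prod_cinv /prod_coords /= row_mxKl row_mxKr !coordsK.
Qed.

Lemma prod_coords_cont i p : prod_dom i p -> {for p, continuous (prod_coords i)}.
Proof.
move=> [ip jp]; apply: continuous_row_mx.
  by apply: (@continuous_comp _ _ _ fst (coords i.1)); [exact: cvg_fst|exact: coords_cont].
by apply: (@continuous_comp _ _ _ snd (coords i.2)); [exact: cvg_snd|exact: coords_cont].
Qed.

Lemma prod_cinv_cont i x : (prod_coords i @` prod_dom i) x -> {for x, continuous (prod_cinv i)}.
Proof.
rewrite prod_codE => -[/= ix jx].
have c1 : {for x, continuous (cinv i.1 \o @lsubmx R 1 n1 n2)}.
  by apply: continuous_comp; [exact: continuous_lsubmx|exact: cinv_cont].
have c2 : {for x, continuous (cinv i.2 \o @rsubmx R 1 n1 n2)}.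
  by apply: continuous_comp; [exact: continuous_rsubmx|exact: cinv_cont].
exact: cvg_pair c1 c2.
Qed.

Lemma prod_transition i j :
  smooth_on (prod_coords i @` (prod_dom i `&` prod_dom j)) (prod_coords j \o prod_cinv i).
Proof.
have -> : prod_dom i `&` prod_dom j =
    (dom i.1 `&` dom j.1) `*` (dom i.2 `&` dom j.2).
  by apply/seteqP; split=> x [[? ?] [? ?]].
rewrite prod_codE.
pose L1 : {linear 'rV[R]_(n1 + n2) -> 'rV[R]_n1} := @lsubmx R 1 n1 n2.
pose L2 : {linear 'rV[R]_(n1 + n2) -> 'rV[R]_n2} := @rsubmx R 1 n1 n2.
pose B1 (x : 'rV[R]_n1) : 'rV[R]_(n1 + n2) := row_mx x 0.
pose B2 (x : 'rV[R]_n2) : 'rV[R]_(n1 + n2) := row_mx 0 x.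
have lB1 : linear B1 by move=> a x y; rewrite /B1 scale_row_mx add_row_mx scaler0 addr0.
have lB2 : linear B2 by move=> a x y; rewrite /B2 scale_row_mx add_row_mx scaler0 addr0.
pose LB1 := GRing.isLinear.Build _ _ _ _ B1 lB1.
pose LB2 := GRing.isLinear.Build _ _ _ _ B2 lB2.
pose B1' : {linear 'rV[R]_n1 -> 'rV[R]_(n1 + n2)} := HB.pack B1 LB1.
pose B2' : {linear 'rV[R]_n2 -> 'rV[R]_(n1 + n2)} := HB.pack B2 LB2.
have cB1 : continuous B1'.
  move=> x; apply: (@continuous_row_mx _ _ _ _ id (cst 0) x).
    exact: cvg_id.
  exact: cst_continuous.
have cB2 : continuous B2'.
  move=> x; apply: (@continuous_row_mx _ _ _ _ (cst 0) id x).
    exact: cst_continuous.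
  exact: cvg_id.
have o1 : open (coords i.1 @` (dom i.1 `&` dom j.1)) by exact: open_overlap.
have o2 : open (coords i.2 @` (dom i.2 `&` dom j.2)) by exact: open_overlap.
move=> k.
have -> : prod_coords j \o prod_cinv i =
    (B1' \o (coords j.1 \o cinv i.1) \o L1) \+
    (B2' \o (coords j.2 \o cinv i.2) \o L2).
  by apply/funext => x /=; rewrite /B1 /B2 add_row_mx addr0 add0r.
apply: CkD; first exact: open_block.
  apply: (@Ck_sub _ _ _ _ (L1 @^-1` (coords i.1 @` (dom i.1 `&` dom j.1)))).
    by move=> x [].
  apply: Ck_lin => //; last exact: transition_smooth.
  exact: continuous_lsubmx.
apply: (@Ck_sub _ _ _ _ (L2 @^-1` (coords i.2 @` (dom i.2 `&` dom j.2)))).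
  by move=> x [].
apply: Ck_lin => //; last exact: transition_smooth.
exact: continuous_rsubmx.
Qed.

Definition prod_manifold : manifold R (n1 + n2) :=
  Manifold prod_nonempty prod_hausdorff prod_second_countable prod_cover
    prod_dom_open prod_cod_open prod_coordsK prod_coords_cont
    prod_cinv_cont prod_transition.

End product.

(** Tensor fields are given by their components in every chart (values at points
    outside the domain of the chart are irrelevant); tangent vectors at [p] are
    row vectors of components, and the differential of a map acts on them by
    [u *m J] with [J] its Jacobian ['J _ _]. *)

Section tensors.
Variables (R : realType) (n : nat) (M : manifold R n).

Definition cod (i : chart M) : set 'rV[R]_n := coords i @` dom i.

Definition tensor2 := chart M -> M -> 'M[R]_n.
Definition covector_field := chart M -> M -> 'rV[R]_n.
Definition vector_field := chart M -> M -> 'rV[R]_n.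

Definition smooth_fun (f : M -> R) := forall i, smooth_on (cod i) (f \o cinv i).

Definition differential (f : M -> R) : covector_field :=
  fun i p => \row_a 'D_(delta_mx 0 a) (f \o cinv i) (coords i p).

Definition symprod (a b : covector_field) : tensor2 :=
  fun i p => (a i p)^T *m b i p + (b i p)^T *m a i p.

Definition inner (G : 'M[R]_n) (u v : 'rV[R]_n) : R := (u *m G *m v^T) 0 0.

Definition riemannian (g : tensor2) :=
  [/\ forall i, smooth_on (cod i) (g i \o cinv i),
      forall i p, dom i p -> (g i p)^T = g i p,
      forall i p, dom i p -> forall u, u != 0 -> 0 < inner (g i p) u u &
      forall i j p, dom i p -> dom j p ->
        let J := 'J (coords j \o cinv i) (coords i p) in
        g i p = J *m g j p *m J^T].

Definition grad (g : tensor2) (f : M -> R) : vector_field :=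
  fun i p => differential f i p *m invmx (g i p).

(** [D i x a b k] is the coefficient [Gamma^k_(ab)] in the chart [i] at the
    point of coordinates [x].  No transformation law is imposed: [levi_civita]
    below determines the coefficients in every chart, see
    [christoffel_levi_civita] for existence. *)
Definition connection := chart M -> 'rV[R]_n -> 'I_n -> 'M[R]_n.

(** Local vector fields on the chart [i], in coordinates. *)
Implicit Types X Y Z : 'rV[R]_n -> 'rV[R]_n.

Definition nabla (D : connection) i X Y : 'rV[R]_n -> 'rV[R]_n :=
  fun x => 'D_(X x) Y x + Y x *m \sum_a X x 0 a *: D i x a.

Definition lie X Y : 'rV[R]_n -> 'rV[R]_n := fun x => 'D_(X x) Y x - 'D_(Y x) X x.

Definition torsion_free (D : connection) := forall i X Y,
  smooth_on (cod i) X -> smooth_on (cod i) Y ->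
  forall x, cod i x -> nabla D i X Y x - nabla D i Y X x = lie X Y x.

Definition metric_compatible (g : tensor2) (D : connection) := forall i X Y Z,
  smooth_on (cod i) X -> smooth_on (cod i) Y -> smooth_on (cod i) Z ->
  forall x, cod i x ->
    'D_(X x) (fun y => inner (g i (cinv i y)) (Y y) (Z y)) x =
      inner (g i (cinv i x)) (nabla D i X Y x) (Z x) +
      inner (g i (cinv i x)) (Y x) (nabla D i X Z x).

Definition levi_civita (g : tensor2) (D : connection) :=
  torsion_free D /\ metric_compatible g D.

Definition curvature (D : connection) i X Y Z : 'rV[R]_n -> 'rV[R]_n :=
  nabla D i X (nabla D i Y Z) \- nabla D i Y (nabla D i X Z)
    \- nabla D i (lie X Y) Z.

(** Being tensorial, the curvature at [p] is evaluated on the extensions of the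
    tangent vectors [u], [v], [w] that are constant in the chart. *)
Definition riemann (D : connection) i (p : M) (u v w : 'rV[R]_n) : 'rV[R]_n :=
  curvature D i (cst u) (cst v) (cst w) (coords i p).

Definition flat (g : tensor2) := exists2 D, levi_civita g D &
  forall i p, dom i p -> forall u v w, riemann D i p u v w = 0.

(** For the sign convention above, [g(R(u,v)v,u)] is positive on spheres. *)
Definition sectional (g : tensor2) (D : connection) i (p : M) (u v : 'rV[R]_n) : R :=
  inner (g i p) (riemann D i p u v v) u /
  (inner (g i p) u u * inner (g i p) v v - inner (g i p) u v ^+ 2).

Definition spans_plane (u v : 'rV[R]_n) := row_free (col_mx u v).

Definition parallel (D : connection) (V : vector_field) :=
  forall i p, dom i p -> forall u, nabla D i (cst u) (V i \o cinv i) (coords i p) = 0.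

End tensors.

Section levi_civita_existence.
Variables (R : realType) (n : nat) (M : manifold R n) (g : tensor2 M).
Variable riem_g : riemannian g.

Lemma metric_unit i p : dom i p -> g i p \in unitmx.
Proof.
have [_ _ pos _] := riem_g => ip; rewrite -row_free_unit; apply: inj_row_free.
move=> u uG0; apply/eqP; apply: contraT => u0.
by have := pos _ _ ip _ u0; rewrite /inner uG0 mul0mx mxE ltxx.
Qed.

Lemma grad_inner f i p v : dom i p ->
  inner (g i p) (grad g f i p) v = (differential f i p *m v^T) 0 0.
Proof. by move=> ip; rewrite /inner /grad mulmxKV // metric_unit. Qed.

Definition christoffel : connection M := fun i x a =>
  \matrix_(b, k) (2^-1 * \sum_l
    let dg e := 'D_(delta_mx 0 e) (g i \o cinv i) x in
    (dg a b l + dg b a l - dg l a b) * invmx (g i (cinv i x)) l k).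

Lemma is_derive_entry (V : normedModType R) m m' (F : V -> 'M[R]_(m, m')) x v a b :
  differentiable F x -> is_derive x v (fun y => F y a b) (('D_v F x) a b).
Proof.
move=> dF; have dFv : derivable F x v by exact: diff_derivable.
have cvgF : h^-1 *: (F (h *: v + x) a b - F x a b) @[h --> 0^'] --> ('D_v F x) a b.
  have := cvg_comp _ _ dFv (@coord_continuous R m m' a b _).
  by apply: cvg_trans; apply: near_eq_cvg; near=> h; rewrite /= !mxE.
split; first by apply/cvg_ex; exists (('D_v F x) a b).
exact: cvg_lim cvgF.
Unshelve. all: by end_near. Qed.

Lemma innerE (G : 'M[R]_n) u v :
  inner G u v = \sum_a \sum_b u 0 a * G a b * v 0 b.
Proof.
rewrite /inner mxE exchange_big; apply: eq_bigr => b _.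
by rewrite !mxE big_distrl.
Qed.

Lemma derive_inner (G : 'rV[R]_n -> 'M[R]_n) (Y Z : 'rV[R]_n -> 'rV[R]_n) x v :
  differentiable G x -> differentiable Y x -> differentiable Z x ->
  'D_v (fun y => inner (G y) (Y y) (Z y)) x =
  inner ('D_v G x) (Y x) (Z x) + inner (G x) ('D_v Y x) (Z x)
  + inner (G x) (Y x) ('D_v Z x).
Proof.
move=> dG dY dZ.
have -> : (fun y => inner (G y) (Y y) (Z y)) =
    \sum_a \sum_b (fun y => Y y 0 a * G y a b * Z y 0 b).
  apply/funext => y; rewrite innerE fct_sumE; apply: eq_bigr => a _.
  by rewrite fct_sumE.
have der a b : is_derive x v (fun y => Y y 0 a * G y a b * Z y 0 b)
   ('D_v Y x 0 a * G x a b * Z x 0 b + Y x 0 a * 'D_v G x a b * Z x 0 b +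
    Y x 0 a * G x a b * 'D_v Z x 0 b).
  have dY' := is_derive_entry v 0 a dY; have dG' := is_derive_entry v a b dG.
  have dZ' := is_derive_entry v 0 b dZ.
  apply: is_derive_eq; rewrite /GRing.scale /=; ring.
rewrite derive_sum => [|a]; last by apply: derivable_sum.
under eq_bigr do rewrite derive_sum //.
rewrite !innerE -!big_split /=; apply: eq_bigr => a _.
rewrite -!big_split /=; apply: eq_bigr => b _; rewrite derive_val; ring.
Qed.

Lemma derive_comb (V : normedModType R) (F : 'rV[R]_n -> V) x (v : 'rV[R]_n) : differentiable F x ->
  'D_v F x = \sum_a v 0 a *: 'D_(delta_mx 0 a) F x.
Proof.
move=> dF; rewrite deriveE // {1}(row_sum_delta v) linear_sum.
by apply: eq_bigr => a _; rewrite linearZ deriveE.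
Qed.

Lemma christoffel_levi_civita : levi_civita g christoffel.
Proof.
have [smg symg _ _] := riem_g.
have oc i : open (@cod _ _ M i) by exact: cod_open.
have dg i x : cod i x -> differentiable (g i \o cinv i) x.
  by move=> ix; have [/(_ x ix)] := smg i 1%N.
have sym i x v a b : cod i x ->
    'D_v (g i \o cinv i) x a b = 'D_v (g i \o cinv i) x b a.
  move=> ix; have d1 := is_derive_entry v a b (dg _ _ ix).
  have d2 := is_derive_entry v b a (dg _ _ ix).
  rewrite -(@derive_val _ _ _ _ _ _ _ d1) -(@derive_val _ _ _ _ _ _ _ d2).
  apply: near_eq_derive.
  have : \forall y \near x, cod i y by exact: open_nbhs_nbhs.
  apply: filterS => y [p ip <-] /=; rewrite coordsK //.
  by rewrite -[in LHS](symg i p ip) mxE.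
split=> [i X Y sX sY x ix|i X Y Z sX sY sZ x ix].
  have chS a b k : christoffel i x a b k = christoffel i x b a k.
    rewrite !mxE; congr (_ * _); apply: eq_bigr => l _ /=.
    by rewrite (sym i x _ a b ix) [X in X - _]addrC.
  rewrite /nabla /lie opprD addrACA [X in _ + X](_ : _ = 0) ?addr0 //.
  apply/eqP; rewrite subr_eq0; apply/eqP/rowP => k; rewrite !mxE.
  under eq_bigr do rewrite summxE big_distrr.
  under [RHS]eq_bigr do rewrite summxE big_distrr.
  rewrite exchange_big; apply: eq_bigr => a _; apply: eq_bigr => b _ /=.
  have zE (A : 'M[R]_n) z : (z *: A) b k = z * A b k by rewrite mxE.
  have zE' (A : 'M[R]_n) z : (z *: A) a k = z * A a k by rewrite mxE.
  by rewrite zE zE' chS mulrCA.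
have dY : differentiable Y x by have [/(_ x ix)] := sY 1%N.
have dZ : differentiable Z x by have [/(_ x ix)] := sZ 1%N.
rewrite (@derive_inner (g i \o cinv i)) //; last exact: dg.
have [p ip px] := ix; have cp : cinv i x = p by rewrite -px coordsK.
set G := g i \o cinv i; set v := X x.
have GU : G x \in unitmx by rewrite /G /= cp metric_unit.
have GS : (G x)^T = G x by rewrite /G /= cp symg.
have key u w : inner (G x) (u *m \sum_a v 0 a *: christoffel i x a) w =
    \sum_a \sum_b \sum_l v 0 a * u 0 b * w 0 l * (2^-1 *
     ('D_(delta_mx 0 a) G x b l + 'D_(delta_mx 0 b) G x a l
      - 'D_(delta_mx 0 l) G x a b)).
  rewrite /inner -!mulmxA mulmx_suml.
  have -> : u *m (\sum_a v 0 a *: christoffel i x a *m (G x *m w^T)) =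
     \sum_a v 0 a *: (u *m (christoffel i x a *m G x *m w^T)).
    rewrite mulmx_sumr; apply: eq_bigr => a _.
    by rewrite -scalemxAl -scalemxAr mulmxA.
  rewrite summxE; apply: eq_bigr => a _.
  have -> : christoffel i x a *m G x = \matrix_(b, l) (2^-1 *
     ('D_(delta_mx 0 a) G x b l + 'D_(delta_mx 0 b) G x a l
      - 'D_(delta_mx 0 l) G x a b)).
    set N := RHS; rewrite -[N](mulmxKV GU); congr (_ *m _).
    apply/matrixP => b k; rewrite !mxE big_distrr /=; apply: eq_bigr => l _.
    by rewrite mxE mulrA.
  rewrite mxE mxE big_distrr; apply: eq_bigr => b _ /=.
  rewrite mxE big_distrr big_distrr; apply: eq_bigr => l _ /=.
  by rewrite !mxE; ring.
rewrite /nabla -/v /G.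
have innerDl A (u1 u2 w : 'rV[R]_n) : inner A (u1 + u2) w = inner A u1 w + inner A u2 w.
  by rewrite /inner !mulmxDl mxE.
have innerDr A (u1 u2 w : 'rV[R]_n) : inner A w (u1 + u2) = inner A w u1 + inner A w u2.
  by rewrite /inner linearD mulmxDr mxE.
have innerC u w : inner (G x) u w = inner (G x) w u.
  by rewrite /inner -[u *m _ *m _]trmxK mxE !trmx_mul trmxK GS mulmxA.
rewrite innerDl innerDr.
rewrite [inner (G x) (Y x) (_ *m _)]innerC !key.
suff -> : inner ('D_v G x) (Y x) (Z x) =
    \sum_a \sum_b \sum_l v 0 a * Y x 0 b * Z x 0 l * 'D_(delta_mx 0 a) G x b l.
  change (g i (cinv i x)) with (G x); set A := (X in X + _ + _ = _); set K1 := (X in _ = _ + X + _).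
  set K2 := (X in _ = _ + (_ + X)).
  suff -> : A = K1 + K2 by ring.
  rewrite /A /K1 /K2 -big_split; apply: eq_bigr => a _ /=.
  rewrite [X in _ = _ + X]exchange_big -big_split; apply: eq_bigr => b _ /=.
  rewrite -big_split; apply: eq_bigr => l _ /=.
  have -> : 'D_(delta_mx 0 a) G x l b = 'D_(delta_mx 0 a) G x b l by exact: sym.
  by field.
rewrite innerE derive_comb; last exact: dg.
under eq_bigr => b _ do under eq_bigr => l _ do
  rewrite summxE big_distrr big_distrl.
under eq_bigr => b _ do rewrite exchange_big.
rewrite exchange_big; apply: eq_bigr => a _; apply: eq_bigr => b _.
by apply: eq_bigr => l _ /=; rewrite !mxE; ring.
Qed.

End levi_civita_existence.

(** [s i] is a chart of [N] containing the image under [F] of the chart [i]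
    of [M]. *)
Definition pullback (R : realType) (m n : nat) (M : manifold R m)
    (N : manifold R n) (F : M -> N) (s : chart M -> chart N) (g : tensor2 N) :
    tensor2 M :=
  fun i p => let J := 'J (coords (s i) \o F \o cinv i) (coords i p) in
    J *m g (s i) (F p) *m J^T.

Section warped.
Variables (R : realType) (n1 n2 : nat) (M1 : manifold R n1) (M2 : manifold R n2).

Definition pr1 : prod_manifold M1 M2 -> M1 := fst.
Definition pr2 : prod_manifold M1 M2 -> M2 := snd.

Definition warped_metric (g1 : tensor2 M1) (g2 : tensor2 M2) (c : R)
    (f1 : M1 -> R) (f2 : M2 -> R) : tensor2 (prod_manifold M1 M2) :=
  let df1h := differential (f1 \o pr1) in
  fun i p =>
    pullback pr1 fst g1 i p
    + (f1 (pr1 p)) ^+ 2 *: pullback pr2 snd g2 i p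
    + (c ^+ 2 / 2 * (f2 (pr2 p)) ^+ 2) *: symprod df1h df1h i p.

End warped.

(** In a product chart, [symprod a a = 2 a^T a] absorbs the factor [1/2]. *)
Section warped_theory.
Variables (R : realType) (n1 n2 : nat) (M1 : manifold R n1) (M2 : manifold R n2).
Variables (g1 : tensor2 M1) (g2 : tensor2 M2) (c : R) (f1 : M1 -> R) (f2 : M2 -> R).
Let M := prod_manifold M1 M2.

Lemma jacobian_linear m n (F : 'rV[R]_m -> 'rV[R]_n) (L : {linear 'rV[R]_m -> 'rV[R]_n})
    x : continuous L -> (\near x, F x = L x) -> 'J F x = lin1_mx L.
Proof.
move=> cL FL; have dL : differentiable L x by exact: linear_differentiable.
have dF : differentiable F x.
  by apply: near_eq_differentiable dL; apply: filterS FL.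
have E v : 'd F x v = L v.
  by rewrite -deriveE // (near_eq_derive v FL) deriveE // diff_lin.
by apply/matrixP => a b; rewrite !mxE E.
Qed.

Lemma near_cod (i : chart M) p : dom i p ->
  \forall y \near coords i p, (coords i @` dom i) y.
Proof. by move=> ip; apply: open_nbhs_nbhs; split; [exact: cod_open|exists p]. Qed.

Lemma jacobian_pr1 (i : chart M) (p : M) : dom i p ->
  'J (coords i.1 \o @pr1 _ _ _ M1 M2 \o cinv i) (coords i p) = col_mx 1%:M 0.
Proof.
move=> ip; rewrite (@jacobian_linear _ _ _ (@lsubmx R 1 n1 n2)).
- apply/row_matrixP => a; apply/rowP => b; rewrite !mxE.
  by case: split_ordP => k ->; rewrite mxE eqxx /= ?eq_lshift ?eq_lrshift // eq_sym.
- exact: continuous_lsubmx.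
apply: filterS (near_cod ip) => y.
by rewrite prod_codE => -[[q iq qy] _] /=; rewrite -qy coordsK.
Qed.

Lemma jacobian_pr2 (i : chart M) (p : M) : dom i p ->
  'J (coords i.2 \o @pr2 _ _ _ M1 M2 \o cinv i) (coords i p) = col_mx 0 1%:M.
Proof.
move=> ip; rewrite (@jacobian_linear _ _ _ (@rsubmx R 1 n1 n2)).
- apply/row_matrixP => a; apply/rowP => b; rewrite !mxE.
  by case: split_ordP => k ->; rewrite mxE eqxx /= ?eq_rshift ?eq_rlshift // eq_sym.
- exact: continuous_rsubmx.
apply: filterS (near_cod ip) => y.
by rewrite prod_codE => -[_ [q iq qy]] /=; rewrite -qy coordsK.
Qed.

Lemma differential_pr1 (f : M1 -> R) (i : chart M) (p : M) : smooth_fun f ->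
  dom i p ->
  differential (f \o @pr1 _ _ _ M1 M2) i p = row_mx (differential f i.1 p.1) 0.
Proof.
move=> smf ip; have [ip1 _] := ip.
have df : differentiable (f \o cinv i.1) (coords i.1 p.1).
  by have [+ _] := smf i.1 1%N; apply; exists p.1.
apply/rowP => a; rewrite mxE.
have -> : (f \o @pr1 _ _ _ M1 M2) \o cinv i = (f \o cinv i.1) \o @lsubmx R 1 n1 n2 by [].
have lp : lsubmx (coords i p) = coords i.1 p.1 by rewrite /= /prod_coords row_mxKl.
have dl : differentiable (@lsubmx R 1 n1 n2) (coords i p).
  exact: differentiable_lsubmx.
rewrite deriveE; last by apply: differentiable_comp => //; rewrite lp.
rewrite diff_comp //; last by rewrite lp.
rewrite /= (@diff_lin _ _ _ (@lsubmx R 1 n1 n2)); last exact: continuous_lsubmx.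
rewrite lp -deriveE //.
rewrite -(splitK a); case: (fintype.split a) => k /=.
  rewrite row_mxEl mxE; congr ('D_ _ _ _); apply/rowP => b.
  by rewrite !mxE !eqxx /= eq_lshift.
rewrite row_mxEr mxE (_ : lsubmx _ = 0) ?derive0 //.
by apply/rowP => b; rewrite !mxE eq_lrshift andbF.
Qed.

Lemma warped_metricE (i : chart M) (p : M) : smooth_fun f1 -> dom i p ->
  let df1 := differential f1 i.1 p.1 in
  warped_metric g1 g2 c f1 f2 i p = block_mx
    (g1 i.1 p.1 + (c * f2 p.2) ^+ 2 *: (df1^T *m df1)) 0
    0 (f1 p.1 ^+ 2 *: g2 i.2 p.2).
Proof.
move=> smf ip df1.
rewrite /warped_metric /pullback jacobian_pr1 // jacobian_pr2 //.
have aux a (w : 'M[R]_(n1 + n2)) : a *: (w + w) = (a *+ 2) *: w.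
  by rewrite scalerDr -scalerDl mulr2n.
rewrite /symprod differential_pr1 // -/df1 aux /pr1 /pr2.
have E1 (G : 'M[R]_n1) : col_mx 1%:M 0 *m G *m (col_mx 1%:M 0)^T =
    block_mx G 0 0 0 :> 'M[R]_(n1 + n2).
  rewrite tr_col_mx mul_col_mx mul_col_row trmx1 trmx0.
  by rewrite !mul0mx !mul1mx !mulmx1 !mulmx0.
have E2 (G : 'M[R]_n2) : col_mx 0 1%:M *m G *m (col_mx 0 1%:M)^T =
    block_mx 0 0 0 G :> 'M[R]_(n1 + n2).
  rewrite tr_col_mx mul_col_mx mul_col_row trmx1 trmx0.
  by rewrite !mul0mx !mul1mx !mulmx1 !mulmx0.
rewrite E1 E2 tr_row_mx mul_col_row trmx0 !mul0mx !mulmx0.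
rewrite !scale_block_mx !add_block_mx !scaler0 !addr0 !add0r.
by congr (block_mx (_ + _ *: _) _ _ _); field.
Qed.

End warped_theory.

(* Main.v *)
Require Import Defs.
From mathcomp Require Import all_boot all_order all_algebra.
From mathcomp Require Import all_classical all_reals all_analysis.
From mathcomp Require Import ring.
Set Implicit Arguments.
Unset Strict Implicit.
Unset Printing Implicit Defensive.
Import Order.TTheory GRing.Theory Num.Theory.
Import numFieldNormedType.Exports.
Local Open Scope classical_set_scope.
Local Open Scope ring_scope.

(** The Koszul formula gives the Levi-Civita connection of [h] in a product chart
    ([cov_warped]).  Parallelism of [grad f1] makes the correction to the horizontal
    part of the base connection of rank one, so the Gauss equation of [M1 x {q}] reads
    [R^1 = 0].  For the fibres [{p} x M2], the Gauss equation is
    [R^2(u, v) w = k (g2(v, w) u - g2(u, w) v)] with [k = b1 / (1 + (c f2)^2 b1)], and the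
    Codazzi equation forces [c^2 b1 df2 = 0] when [dim M2 >= 2]; so [k], which a priori
    depends on the point of [M2], is constant. *)

(** Since [grad f1] is parallel, so is [df1], and [nabla1] is compatible both with [g1] and with
    every slice metric [g1 + (c f2(q))^2 df1^2]; hence each slice [M1 x {q}] carries [nabla1]
    itself. The denominator [1 + (c f2)^2 b1] is the Sherman-Morrison factor of this rank-one
    perturbation: the gradient of [f1] for the slice metric is [grad f1] divided by it. On the
    fibres, whose induced metric is [f1^2 g2], the warping factor cancels in the Gauss equation, so
    [k] cannot depend on the point of [M1]. Connections are given only through torsion-freeness and
    metric compatibility, so the differentiability behind the curvature has to be recovered from the
    Koszul formula. *)

(** * Differentiation of matrix-valued maps *)

Section calculus.
Variables (R : realType) (V : normedModType R).

Lemma differentiable_mx m n (F : V -> 'M[R]_(m, n)) x :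
  (forall a b, differentiable (fun y => F y a b) x) -> differentiable F x.
Proof.
move=> dF.
have -> : F = \sum_a \sum_b (fun y => F y a b *: delta_mx a b).
  apply/funext => y; rewrite [LHS]matrix_sum_delta fct_sumE.
  by apply: eq_bigr => a _; rewrite fct_sumE.
apply: differentiable_sum => a; apply: differentiable_sum => b.
exact: differentiableZl.
Qed.

Lemma differentiable_entry m n (F : V -> 'M[R]_(m, n)) x a b :
  differentiable F x -> differentiable (fun y => F y a b) x.
Proof.
move=> dF.
by apply: (@differentiable_comp _ _ _ _ F (fun N : 'M[R]_(m, n) => N a b)) => //;
  exact: differentiable_coord.
Qed.

Lemma differentiable_sumf (I : Type) (r : seq I) (P : pred I) (f : I -> V -> R) x :
  (forall i, differentiable (f i) x) ->
  differentiable (fun y => \sum_(i <- r | P i) f i y) x.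
Proof.
move=> df; rewrite (_ : (fun y => _) = \sum_(i <- r | P i) f i).
  by elim/big_ind : _ => // g h dg dh; apply: differentiableD.
by apply/funext => y; rewrite fct_sumE.
Qed.

Lemma differentiable_prodf (I : Type) (r : seq I) (P : pred I) (f : I -> V -> R) x :
  (forall i, differentiable (f i) x) ->
  differentiable (fun y => \prod_(i <- r | P i) f i y) x.
Proof.
move=> df; elim: r => [|i r IH].
  by under eq_fun do rewrite big_nil; exact: differentiable_cst.
under eq_fun do rewrite big_cons; case: (P i) => //.
by apply: differentiableM.
Qed.

Lemma differentiable_mulmx m n p (F : V -> 'M[R]_(m, n)) (G : V -> 'M[R]_(n, p)) x :
  differentiable F x -> differentiable G x ->
  differentiable (fun y => F y *m G y) x.
Proof.
move=> dF dG; apply: differentiable_mx => a b; under eq_fun do rewrite mxE.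
by apply: differentiable_sumf => k; apply: differentiableM;
  exact: differentiable_entry.
Qed.

Lemma differentiable_trmx m n (F : V -> 'M[R]_(m, n)) x :
  differentiable F x -> differentiable (fun y => (F y)^T) x.
Proof.
move=> dF; apply: differentiable_mx => a b; under eq_fun do rewrite mxE.
exact: differentiable_entry.
Qed.

Lemma differentiable_det n (F : V -> 'M[R]_n) x :
  differentiable F x -> differentiable (fun y => \det (F y)) x.
Proof.
move=> dF; apply: differentiable_sumf => s.
apply: differentiableM; first exact: differentiable_cst.
by apply: differentiable_prodf => a; exact: differentiable_entry.
Qed.

Lemma differentiable_invmx n (F : V -> 'M[R]_n) x :
  (\near x, F x \in unitmx) -> differentiable F x ->
  differentiable (fun y => invmx (F y)) x.
Proof.
move=> uF dF.
(* On a singular matrix [invmx] returns its argument by default, so Cramer's formula represents it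
   only on the neighbourhood where [F] is invertible. *)
apply: (@near_eq_differentiable _ _ _ (fun y => (\det (F y))^-1 *: \adj (F y))).
  by apply: filterS uF => y uy; rewrite /invmx uy.
apply: differentiable_mx => a b; under eq_fun do rewrite !mxE.
apply: differentiableM.
  apply: differentiableV; first exact: differentiable_det.
  by have := nbhs_singleton uF; rewrite unitmxE unitfE.
apply: differentiableM; first exact: differentiable_cst.
apply: differentiable_det; apply: differentiable_mx => i j.
by under eq_fun do rewrite !mxE; exact: differentiable_entry.
Qed.

Lemma differentiable_inner n (G : V -> 'M[R]_n) (Y Z : V -> 'rV[R]_n) x :
  differentiable G x -> differentiable Y x -> differentiable Z x ->
  differentiable (fun y => inner (G y) (Y y) (Z y)) x.
Proof.
move=> dG dY dZ; apply: differentiable_entry; apply: differentiable_mulmx.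
  exact: differentiable_mulmx.
exact: differentiable_trmx.
Qed.

Lemma is_derive_rowP n (F : V -> 'rV[R]_n) x v (d : 'rV[R]_n) :
  (forall b, is_derive x v (fun y => F y 0 b) (d 0 b)) -> is_derive x v F d.
Proof.
move=> dF; have dvF : derivable F x v.
  by apply/derivable_mxP => a b; rewrite ord1; exact: ex_derive.
apply: DeriveDef => //; rewrite derive_mx //.
by apply/rowP => b; rewrite mxE derive_val.
Qed.

Lemma is_derive_row_coord n (F : V -> 'rV[R]_n) x v (d : 'rV[R]_n) b :
  is_derive x v F d -> is_derive x v (fun y => F y 0 b) (d 0 b).
Proof.
move=> dF; have dvF : derivable F x v by exact: ex_derive.
apply: DeriveDef; first by move/derivable_mxP: dvF; exact.
by rewrite -(@derive_val _ _ _ _ _ _ _ dF) derive_mx // mxE.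
Qed.

Lemma is_derive_row_mx n1 n2 (F : V -> 'rV[R]_n1) (G : V -> 'rV[R]_n2) x v d e :
  is_derive x v F d -> is_derive x v G e ->
  is_derive x v (fun y => row_mx (F y) (G y)) (row_mx d e).
Proof.
move=> dF dG; apply: is_derive_rowP => b; rewrite -(splitK b).
case: (fintype.split b) => k /=.
  by under eq_fun do rewrite row_mxEl; rewrite row_mxEl; exact: is_derive_row_coord.
by under eq_fun do rewrite row_mxEr; rewrite row_mxEr; exact: is_derive_row_coord.
Qed.

Lemma is_derive_inv (f : V -> R) x v d : f x != 0 ->
  is_derive x v f d -> is_derive x v (fun y => (f y)^-1) (- ((f x)^-1 ^+ 2 * d)).
Proof.
move=> fx0 df; have dfv : derivable f x v by exact: ex_derive.
split; first exact: derivableV.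
by rewrite deriveV // (@derive_val _ _ _ _ _ _ _ df) exprVn scaleNr.
Qed.

Lemma is_derive_scaler n (k : V -> R) (w : 'rV[R]_n) x v d :
  is_derive x v k d -> is_derive x v (fun y => k y *: w) (d *: w).
Proof.
move=> dk; apply: is_derive_rowP => b; rewrite mxE; under eq_fun do rewrite mxE.
by apply: is_derive_eq; rewrite /GRing.scale /= mulr0 add0r mulrC.
Qed.

End calculus.

(** * From vanishing derivatives to constancy *)

Section constancy.

(** Mean value theorem along the segment from [x] to [y], which stays in a ball where the
    derivatives vanish. *)
Lemma derive0_near_cst (R : realType) (V : normedModType R) (f : V -> R) x :
  (\forall y \near x, differentiable f y /\ forall v, 'D_v f y = 0) ->
  \forall y \near x, f y = f x.
Proof.
move=> /nbhs_ballP[e /= e0 xe]; apply/nbhs_ballP; exists e => //= y.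
rewrite -ball_normE /= => xy; set v := y - x; pose h (t : R) := f (t *: v + x).
have hE (t s : R) : (t *: 1 + s) *: v + x = t *: v + (s *: v + x).
  by rewrite addrA -scalerDl [t *: 1]mulr1.
have d0 (t : R) : t \in `[0, 1]%R -> is_derive t 1 h 0.
  rewrite in_itv /= => /andP[t0 t1].
  have [|df f0] := xe (t *: v + x).
    rewrite -ball_normE /= opprD addrCA subrr addr0 normrN normrZ ger0_norm //.
    by rewrite distrC in xy; apply: le_lt_trans xy; rewrite ler_piMl.
  have /cvg_ex[l fl] : derivable f (t *: v + x) v by exact: diff_derivable.
  (* The difference quotient of [h] at [t] is that of [f] at [t *: v + x] in the direction [v]. *)
  have hl : s^-1 *: ((h \o shift t) (s *: 1) - h t) @[s --> 0^'] --> l.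
    by apply: cvg_trans fl; apply: near_eq_cvg; near=> s; rewrite /h /= hE.
  split; first by apply/cvg_ex; exists l.
  by rewrite -(f0 v) /derive (cvg_lim _ hl) // (cvg_lim _ fl).
have dh (t : R) : t \in `]0, 1[%R -> is_derive t 1 h ((fun=> 0) t).
  by move=> /subset_itv_oo_cc; exact: d0.
have ch : {within `[0, 1], continuous h}.
  by apply: derivable_within_continuous => t /d0 [].
have [c _] := MVT_segment (@ler01 R) dh ch.
rewrite mul0r /h scale1r scale0r add0r subrK => /eqP.
by rewrite subr_eq0 => /eqP.
Unshelve. all: by end_near. Qed.

(** Level sets are open, and the complement of one is a union of others, so the level set through
    [p] is clopen and nonempty. *)
Lemma connected_near_cst (T : topologicalType) (U : Type) (f : T -> U) :
  connected [set: T] -> (forall p, \forall q \near p, f q = f p) ->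
  forall p q, f p = f q.
Proof.
move=> cT lf p q; have oF A : open (f @^-1` A).
  by rewrite openE => x Ax; apply: filterS (lf x) => y; rewrite /preimage /= => ->.
have : [set x | f x = f p] = [set: T].
  apply: cT; first by exists p.
    by exists [set x | f x = f p]; [exact: (oF [set f p])|rewrite setTI].
  exists [set x | f x = f p]; rewrite ?setTI //.
  by rewrite -[X in closed X]setCK; apply: open_closedC; exact: (oF (~` [set f p])).
by move=> /seteqP[_ /(_ q I)].
Qed.

End constancy.

(** * Derivatives along the factors of a product chart *)

Section slices.
Variables (R : realType) (n1 n2 : nat) (W : normedModType R).
Implicit Types (K : 'rV[R]_(n1 + n2) -> W) (x : 'rV[R]_(n1 + n2)).

(** Both sides are limits of one and the same difference quotient. This turns a derivative in the
    product chart into one in a single factor, the other coordinates being frozen. *)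
Lemma derive_rowl K x u :
  'D_(row_mx u 0) K x = 'D_u (fun y => K (row_mx y (rsubmx x))) (lsubmx x).
Proof.
rewrite /derive; set F := (X in X @ _); set G := (X in _ = lim (X @ _)).
suff -> : F = G by [].
apply/funext => h; rewrite /F /G /=.
congr (_ *: (K _ - K _)); last by rewrite hsubmxK.
by rewrite -{1}[x]hsubmxK scale_row_mx add_row_mx scaler0 add0r.
Qed.

Lemma derive_rowr K x u :
  'D_(row_mx 0 u) K x = 'D_u (fun y => K (row_mx (lsubmx x) y)) (rsubmx x).
Proof.
rewrite /derive; set F := (X in X @ _); set G := (X in _ = lim (X @ _)).
suff -> : F = G by [].
apply/funext => h; rewrite /F /G /=.
congr (_ *: (K _ - K _)); last by rewrite hsubmxK.
by rewrite -{1}[x]hsubmxK scale_row_mx add_row_mx scaler0 add0r.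
Qed.

Lemma is_derive_lsubmx (f : 'rV[R]_n1 -> W) x u :
  differentiable f (lsubmx x) ->
  is_derive x u (fun y => f (lsubmx y)) ('D_(lsubmx u) f (lsubmx x)).
Proof.
move=> df; have dl : differentiable (@lsubmx R 1 n1 n2) x by exact: differentiable_lsubmx.
have dfl : differentiable (f \o @lsubmx R 1 n1 n2) x by exact: differentiable_comp.
split; first exact: diff_derivable.
rewrite !deriveE // (@diff_comp _ _ _ _ (@lsubmx R 1 n1 n2) f) //=.
by rewrite (@diff_lin _ _ _ (@lsubmx R 1 n1 n2)) //; exact: continuous_lsubmx.
Qed.

Lemma is_derive_rsubmx (f : 'rV[R]_n2 -> W) x u :
  differentiable f (rsubmx x) ->
  is_derive x u (fun y => f (rsubmx y)) ('D_(rsubmx u) f (rsubmx x)).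
Proof.
move=> df; have dl : differentiable (@rsubmx R 1 n1 n2) x by exact: differentiable_rsubmx.
have dfl : differentiable (f \o @rsubmx R 1 n1 n2) x by exact: differentiable_comp.
split; first exact: diff_derivable.
rewrite !deriveE // (@diff_comp _ _ _ _ (@rsubmx R 1 n1 n2) f) //=.
by rewrite (@diff_lin _ _ _ (@rsubmx R 1 n1 n2)) //; exact: continuous_rsubmx.
Qed.

End slices.

(** * Bilinear algebra of metrics in coordinates *)

Section inner_theory.
Variables (R : realType) (n : nat) (G : 'M[R]_n).
Implicit Types u v w : 'rV[R]_n.

Lemma innerDl u v w : inner G (u + v) w = inner G u w + inner G v w.
Proof. by rewrite /inner !mulmxDl mxE. Qed.

Lemma innerDr u v w : inner G w (u + v) = inner G w u + inner G w v.
Proof. by rewrite /inner linearD mulmxDr mxE. Qed.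

Lemma innerZl a u w : inner G (a *: u) w = a * inner G u w.
Proof. by rewrite /inner -!scalemxAl mxE. Qed.

Lemma innerZr a u w : inner G w (a *: u) = a * inner G w u.
Proof. by rewrite /inner linearZ -scalemxAr mxE. Qed.

Lemma inner0l w : inner G 0 w = 0.
Proof. by rewrite /inner !mul0mx mxE. Qed.

Lemma inner0r w : inner G w 0 = 0.
Proof. by rewrite /inner trmx0 mulmx0 mxE. Qed.

Lemma innerNl u w : inner G (- u) w = - inner G u w.
Proof. by rewrite -scaleN1r innerZl mulN1r. Qed.

Lemma innerC u v : G^T = G -> inner G u v = inner G v u.
Proof. by move=> GT; rewrite /inner -[u *m _ *m _]trmxK mxE !trmx_mul trmxK GT mulmxA. Qed.

Lemma inner_addM (H : 'M[R]_n) u v : inner (G + H) u v = inner G u v + inner H u v.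
Proof. by rewrite /inner mulmxDr mulmxDl mxE. Qed.

Lemma inner_scaleM a u v : inner (a *: G) u v = a * inner G u v.
Proof. by rewrite /inner -scalemxAr -scalemxAl mxE. Qed.

Lemma inner_mulmx_delta u b : inner G u (delta_mx 0 b) = (u *m G) 0 b.
Proof. by rewrite /inner trmx_delta -colE mxE. Qed.

End inner_theory.

Lemma smooth_on_cst (R : realType) (V W : normedModType R) (U : set V) (u : W) :
  smooth_on U (cst u).
Proof.
move=> k; elim: k u => [|k IH] u /=; first by move=> x _; exact: cst_continuous.
split=> [x _|v]; first exact: differentiable_cst.
by rewrite (_ : (fun x => _) = cst 0) //; apply/funext => x; exact: derive_cst.
Qed.

(** * Curvature and the Koszul formula in a chart *)

Section covariant_derivative.
Variables (R : realType) (n : nat) (M : manifold R n).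
Implicit Types (D : connection M) (u v w : 'rV[R]_n).

(** [cov D i x u v] is nabla_u v at [x], for vector fields constant in the chart [i]. *)
Definition cov D i x u v : 'rV[R]_n := v *m \sum_a u 0 a *: D i x a.

Lemma covZl D i x a u w : cov D i x (a *: u) w = a *: cov D i x u w.
Proof.
rewrite /cov scalemxAr scaler_sumr; congr (_ *m _); apply: eq_bigr => b _.
by rewrite mxE scalerA.
Qed.

Lemma cov0l D i x w : cov D i x 0 w = 0.
Proof. by rewrite -[X in cov _ _ _ X _](scale0r 0) covZl scale0r. Qed.

Lemma nabla_cst D i x u v : nabla D i (cst u) (cst v) x = cov D i x u v.
Proof. by rewrite /nabla derive_cst add0r. Qed.

Lemma lie_cst u v : lie (cst u) (cst v) = cst 0.
Proof. by apply/funext => x; rewrite /lie !derive_cst subrr. Qed.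

Lemma riemannE D i p u v w : let x := coords i p in
  riemann D i p u v w =
  ('D_u (fun y => cov D i y v w) x + cov D i x u (cov D i x v w)) -
  ('D_v (fun y => cov D i y u w) x + cov D i x v (cov D i x u w)).
Proof.
move=> x; have E a b : nabla D i (cst a) (cst b) = fun y => cov D i y a b.
  by apply/funext => y; exact: nabla_cst.
rewrite /riemann /curvature !E lie_cst E -/x.
transitivity (nabla D i (cst u) (fun y => cov D i y v w) x -
  nabla D i (cst v) (fun y => cov D i y u w) x - cov D i x 0 w); first by [].
by rewrite cov0l subr0.
Qed.

End covariant_derivative.

Section levi_civita_theory.
Variables (R : realType) (n : nat) (M : manifold R n) (g : tensor2 M).
Variables (D : connection M) (lcD : levi_civita g D).

Lemma covC i x u v : cod i x -> cov D i x u v = cov D i x v u.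
Proof.
move=> ix; have [tf _] := lcD.
have := tf i (cst u) (cst v) (smooth_on_cst _ u) (smooth_on_cst _ v) x ix.
by rewrite !nabla_cst lie_cst => /eqP; rewrite subr_eq0 => /eqP.
Qed.

Lemma derive_metric_cst i x u v w : cod i x ->
  'D_u (fun y => inner (g i (cinv i y)) v w) x =
  inner (g i (cinv i x)) (cov D i x u v) w + inner (g i (cinv i x)) v (cov D i x u w).
Proof.
move=> ix; have [_ mc] := lcD.
have := mc i _ _ _ (smooth_on_cst _ u) (smooth_on_cst _ v) (smooth_on_cst _ w) x ix.
by rewrite !nabla_cst.
Qed.

(** The bracket terms of the usual formula are absent because constant fields commute. Symmetry is a
    separate hypothesis so that the formula applies to the warped metric, which is never packaged as
    [riemannian]. *)
Lemma koszul i x u v w : cod i x ->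
  (forall a b, inner (g i (cinv i x)) a b = inner (g i (cinv i x)) b a) ->
  2 * inner (g i (cinv i x)) (cov D i x u v) w =
  'D_u (fun y => inner (g i (cinv i y)) v w) x +
  'D_v (fun y => inner (g i (cinv i y)) u w) x -
  'D_w (fun y => inner (g i (cinv i y)) u v) x.
Proof.
move=> ix gC; rewrite !derive_metric_cst // (covC u w) // (covC v w) // (covC v u) //.
by rewrite (gC v); ring.
Qed.

End levi_civita_theory.

Lemma cod_nbhs (R : realType) (n : nat) (M : manifold R n) (i : chart M) x :
  cod i x -> \forall y \near x, cod i y.
Proof. by move=> ix; apply: open_nbhs_nbhs; split=> //; exact: cod_open. Qed.

Lemma cod_dom (R : realType) (n : nat) (M : manifold R n) (i : chart M) x :
  cod i x -> dom i (cinv i x) /\ coords i (cinv i x) = x.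
Proof. by move=> [p ip <-]; rewrite coordsK. Qed.

Lemma dom_nbhs (R : realType) (n : nat) (M : manifold R n) (i : chart M) p
    (P : set 'rV[R]_n) : dom i p -> (\forall y \near coords i p, P y) ->
  \forall q \near p, dom i q /\ P (coords i q).
Proof.
move=> ip nP; apply: filterI; first by apply: open_nbhs_nbhs; split=> //; exact: dom_open.
exact: (coords_cont ip nP).
Qed.

(** * Regularity of the connection; parallel gradients *)

Section riemannian_theory.
Variables (R : realType) (n : nat) (M : manifold R n) (g : tensor2 M).
Variables (D : connection M) (riem_g : riemannian g) (lcD : levi_civita g D).
Local Notation G i := (g i \o cinv i).

Lemma metric_sym i x : cod i x -> (g i (cinv i x))^T = g i (cinv i x).
Proof. by have [_ sg _ _] := riem_g; case/cod_dom => ix _; exact: sg. Qed.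

Lemma metric_unitmx i x : cod i x -> g i (cinv i x) \in unitmx.
Proof. by case/cod_dom => ix _; exact: metric_unit. Qed.

Lemma differentiable_metric i x : cod i x -> differentiable (G i) x.
Proof. by move=> ix; have [/(_ i 1%N) [dg _] _ _ _] := riem_g; exact: dg. Qed.

Lemma differentiable_derive_metric i x u : cod i x -> differentiable ('D_u (G i)) x.
Proof. by move=> ix; have [/(_ i 2%N) [_ /(_ u) [dg _]] _ _ _] := riem_g; exact: dg. Qed.

Lemma differentiable_invmx_metric i x : cod i x ->
  differentiable (fun y => invmx (g i (cinv i y))) x.
Proof.
move=> ix; apply: differentiable_invmx; last exact: differentiable_metric.
by apply: filterS (cod_nbhs ix) => y; exact: metric_unitmx.
Qed.

Lemma derive_metric_inner i x u v w : cod i x ->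
  'D_u (fun y => inner (g i (cinv i y)) v w) x = inner ('D_u (G i) x) v w.
Proof.
move=> ix; have dc a : differentiable (cst a : 'rV[R]_n -> 'rV[R]_n) x.
  exact: differentiable_cst.
have := @derive_inner _ _ _ (cst v) (cst w) _ u (differentiable_metric ix) (dc v) (dc w).
by rewrite /= !derive_cst inner0l inner0r !addr0.
Qed.

(** [levi_civita] prescribes [D] point by point and mentions no regularity. The Koszul formula
    expresses it by first derivatives of the metric, which are differentiable. *)
Lemma differentiable_cov i x u v : cod i x -> differentiable (fun y => cov D i y u v) x.
Proof.
(* [K y] is [cov D i y u v] with its index lowered by the metric, as the Koszul formula gives it;
   the inverse metric raises it again. *)
move=> ix; pose K y : 'rV[R]_n := \row_l (2^-1 *
  (inner ('D_u (G i) y) v (delta_mx 0 l) + inner ('D_v (G i) y) u (delta_mx 0 l) -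
   inner ('D_(delta_mx 0 l) (G i) y) u v)).
apply: (@near_eq_differentiable _ _ _ (fun y => K y *m invmx (g i (cinv i y)))).
  apply: filterS (cod_nbhs ix) => y iy.
  rewrite -[RHS](mulmxK (metric_unitmx iy)); congr (_ *m _).
  apply/rowP => l; rewrite mxE -inner_mulmx_delta -!derive_metric_inner //.
  rewrite -(koszul lcD) //; first by rewrite mulKf // pnatr_eq0.
  by move=> a b; rewrite innerC // metric_sym.
apply: differentiable_mulmx; last exact: differentiable_invmx_metric.
apply: differentiable_mx => a l; under eq_fun do rewrite mxE.
apply: differentiableM; first exact: differentiable_cst.
by apply: differentiableB; first apply: differentiableD;
  apply: differentiable_inner; (exact: differentiable_derive_metric || exact: differentiable_cst).
Qed.

(** [metric_compatible] speaks of fields smooth on the whole chart. Applied to constant fields and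
    combined with the product rule, it extends to fields differentiable at [x], which is what is
    known here of the gradient. *)
Lemma derive_inner_cov i x u (Y Z : 'rV[R]_n -> 'rV[R]_n) : cod i x ->
  differentiable Y x -> differentiable Z x ->
  'D_u (fun y => inner (g i (cinv i y)) (Y y) (Z y)) x =
  inner (g i (cinv i x)) ('D_u Y x + cov D i x u (Y x)) (Z x) +
  inner (g i (cinv i x)) (Y x) ('D_u Z x + cov D i x u (Z x)).
Proof.
move=> ix dY dZ; rewrite (@derive_inner _ _ (G i)) //; last exact: differentiable_metric.
rewrite -derive_metric_inner // (derive_metric_cst lcD) // innerDl innerDr /=.
ring.
Qed.

Variables (f : M -> R) (smf : smooth_fun f).

Lemma differentiable_fun i x : cod i x -> differentiable (f \o cinv i) x.
Proof. by move=> ix; have [df _] := smf i 1%N; exact: df. Qed.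

Lemma differential_cinv i x : cod i x ->
  differential f i (cinv i x) = \row_a 'D_(delta_mx 0 a) (f \o cinv i) x.
Proof. by rewrite /differential => /cod_dom[_ ->]. Qed.

Lemma inner_grad i x v : cod i x ->
  inner (g i (cinv i x)) (grad g f i (cinv i x)) v = 'D_v (f \o cinv i) x.
Proof.
move=> ix; have [ip _] := cod_dom ix.
rewrite (grad_inner riem_g) // differential_cinv // derive_comb; last exact: differentiable_fun.
by rewrite mxE; apply: eq_bigr => a _; rewrite !mxE mulrC.
Qed.

Lemma differentiable_grad i x : cod i x -> differentiable (grad g f i \o cinv i) x.
Proof.
move=> ix; apply: differentiable_mulmx; last exact: differentiable_invmx_metric.
apply: (@near_eq_differentiable _ _ _ (fun y => \row_a 'D_(delta_mx 0 a) (f \o cinv i) y)).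
  by apply: filterS (cod_nbhs ix) => y iy; rewrite /= differential_cinv.
apply: differentiable_mx => a b; under eq_fun do rewrite mxE.
by have [_ /(_ (delta_mx 0 b)) [df _]] := smf i 2%N; exact: df.
Qed.

Hypothesis par : parallel D (grad g f).

Lemma parallel_derive i x u : cod i x ->
  'D_u (grad g f i \o cinv i) x + cov D i x u (grad g f i (cinv i x)) = 0.
Proof. by move=> ix; have [ip xE] := cod_dom ix; have := par ip u; rewrite /nabla xE. Qed.

(** The Hessian of [f] vanishes. This keeps second derivatives of [f1] out of the derivative of the
    warped metric. *)
Lemma derive_inner_grad i x u v : cod i x ->
  'D_u (fun y => inner (g i (cinv i y)) (grad g f i (cinv i y)) v) x =
  inner (g i (cinv i x)) (grad g f i (cinv i x)) (cov D i x u v).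
Proof.
move=> ix; have := @derive_inner_cov i x u (grad g f i \o cinv i) (cst v) ix
  (differentiable_grad ix) (@differentiable_cst _ _ _ v x).
by rewrite parallel_derive // inner0l add0r derive_cst add0r.
Qed.

Lemma derive_grad_norm i x u : cod i x ->
  'D_u (fun y => inner (g i (cinv i y)) (grad g f i (cinv i y)) (grad g f i (cinv i y))) x = 0.
Proof.
move=> ix; have := @derive_inner_cov i x u _ _ ix (differentiable_grad ix) (differentiable_grad ix).
by rewrite parallel_derive // inner0l inner0r addr0.
Qed.

(** [grad g f i p] is only a component vector, so its independence of the chart is
    obtained from the transformation laws of [df] and [g]. *)
Lemma grad_norm_chart i j p : dom i p -> dom j p ->
  inner (g i p) (grad g f i p) (grad g f i p) =
  inner (g j p) (grad g f j p) (grad g f j p).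
Proof.
move=> ip jp; have [_ sg _ tg] := riem_g; have gij := tg i j p ip jp.
pose phi := coords j \o cinv i; pose x := coords i p.
have ovx : (coords i @` (dom i `&` dom j)) x by exists p.
have dphi : differentiable phi x.
  by have [dp _] := @transition_smooth _ _ M i j 1%N; exact: dp.
set J := 'J _ _ in gij.
have phix : phi x = coords j p by rewrite /phi /x /= coordsK.
have dfj : differentiable (f \o cinv j) (phi x).
  by apply: differentiable_fun; rewrite phix; exists p.
have dfE : differential f i p = differential f j p *m J^T.
  apply/rowP => a; rewrite !mxE.
  have fE : \forall y \near x, (f \o cinv i) y = ((f \o cinv j) \o phi) y.
    have : \forall y \near x, (coords i @` (dom i `&` dom j)) y.
      by apply: open_nbhs_nbhs; split=> //; exact: open_overlap.
    by apply: filterS => y [q [iq jq] <-]; rewrite /phi /= !coordsK.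
  rewrite (near_eq_derive _ fE) deriveE; last exact: differentiable_comp.
  rewrite diff_comp // /= -(@deriveE _ _ _ (f \o cinv j)) // derive_comb // phix.
  by apply: eq_bigr => b _; rewrite !mxE mulrC.
(* Invertibility of the Jacobian is read off from the transformation law: [J] is a factor of the
   invertible matrix [g i p]. *)
have uJ : J \in unitmx.
  by have := metric_unit riem_g ip; rewrite gij !unitmx_mul => /andP[/andP[]].
have uj := metric_unit riem_g jp.
have key k : dom k p -> inner (g k p) (grad g f k p) (grad g f k p) =
    (differential f k p *m invmx (g k p) *m (differential f k p)^T) 0 0.
  move=> kp; rewrite /inner /grad mulmxKV ?metric_unit //.
  by rewrite trmx_mul trmx_inv sg // mulmxA.
have ui := metric_unit riem_g ip.
have JE : J^T *m invmx (g i p) = invmx (g j p) *m invmx J.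
  rewrite -[RHS](mulmxK ui); congr (_ *m _).
  by rewrite gij !mulmxA mulmxKV // mulVmx // mul1mx.
by rewrite !key // dfE trmx_mul trmxK -(mulmxA (differential f j p)) JE !mulmxA mulmxKV.
Qed.

Lemma grad_norm_cst : connected [set: M] ->
  exists b, forall i p, dom i p -> inner (g i p) (grad g f i p) (grad g f i p) = b.
Proof.
(* Choosing a chart at each point makes the squared norm a function [N] on [M]; chart independence
   then lets nearby points be compared in one chart. *)
move=> cM; pose ch (p : M) := projT1 (cid (man_cover p)).
have dch p : dom (ch p) p by rewrite /ch; case: cid.
pose N p := inner (g (ch p) p) (grad g f (ch p) p) (grad g f (ch p) p).
have [p0 _] := man_nonempty M; exists (N p0) => i p ip.
rewrite (grad_norm_chart ip (dch p)) -/(N p).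
apply: (connected_near_cst cM) => {i ip}p.
set i := ch p; have ip : dom i p by exact: dch.
pose h y := inner (g i (cinv i y)) (grad g f i (cinv i y)) (grad g f i (cinv i y)).
have hp : \forall y \near coords i p, h y = h (coords i p).
  apply: derive0_near_cst.
  have : \forall y \near coords i p, cod i y by apply: cod_nbhs; exists p.
  apply: filterS => y iy; split=> [|v]; last exact: derive_grad_norm.
  by apply: differentiable_inner; [exact: differentiable_metric|exact: differentiable_grad..].
apply: filterS (dom_nbhs ip hp) => q [iq].
by rewrite /h !coordsK // => E; rewrite /N (grad_norm_chart (dch q) iq).
Qed.

End riemannian_theory.

(** * The Levi-Civita connection of the warped metric *)

Lemma inner_block (R : realType) n1 n2 (A : 'M[R]_n1) (B : 'M[R]_n2) (v w : 'rV[R]_(n1 + n2)) :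
  inner (block_mx A 0 0 B) v w =
  inner A (lsubmx v) (lsubmx w) + inner B (rsubmx v) (rsubmx w).
Proof.
rewrite /inner -{1}[v]hsubmxK -{1}[w]hsubmxK mul_row_block !mulmx0 addr0 add0r.
by rewrite tr_row_mx mul_row_col mxE.
Qed.

Lemma inner_rank1 (R : realType) n (d v w : 'rV[R]_n) :
  inner (d^T *m d) v w = (d *m v^T) 0 0 * (d *m w^T) 0 0.
Proof.
rewrite /inner !mulmxA -[_ *m w^T]mulmxA [LHS]mxE big_ord1; congr (_ * _).
by rewrite -[v *m _]trmxK mxE trmx_mul trmxK.
Qed.

Lemma inner_ge0 (R : realType) n (M : manifold R n) (g : tensor2 M) i p u :
  riemannian g -> dom i p -> 0 <= inner (g i p) u u.
Proof.
move=> [_ _ pos _] ip; have [->|u0] := eqVneq u 0; first by rewrite inner0l.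
by rewrite ltW // pos.
Qed.

Lemma inner_eq0 (R : realType) n (M : manifold R n) (g : tensor2 M) i p u :
  riemannian g -> dom i p -> (inner (g i p) u u == 0) = (u == 0).
Proof.
move=> [_ _ pos _] ip; have [->|u0] := eqVneq u 0; first by rewrite inner0l eqxx.
by rewrite gt_eqF // pos.
Qed.

Section warped_connection.
Variables (R : realType) (n1 n2 : nat) (M1 : manifold R n1) (M2 : manifold R n2).
Variables (g1 : tensor2 M1) (g2 : tensor2 M2) (D1 : connection M1) (D2 : connection M2).
Variables (c : R) (f1 : M1 -> R) (f2 : M2 -> R).
Hypotheses (riem1 : riemannian g1) (riem2 : riemannian g2).
Hypotheses (lc1 : levi_civita g1 D1) (lc2 : levi_civita g2 D2).
Hypotheses (smf1 : smooth_fun f1) (smf2 : smooth_fun f2) (f1_gt0 : forall p, 0 < f1 p).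
Hypothesis par : parallel D1 (grad g1 f1).
Let M := prod_manifold M1 M2.
Local Notation h := (warped_metric g1 g2 c f1 f2).

Lemma cod_prod (i : chart M) x : cod i x -> cod i.1 (lsubmx x) /\ cod i.2 (rsubmx x).
Proof. by rewrite /cod prod_codE => -[]. Qed.

Lemma cod_row_mx (i : chart M) x1 x2 : cod i.1 x1 -> cod i.2 x2 -> cod i (row_mx x1 x2).
Proof. by move=> ix1 ix2; rewrite /cod prod_codE; split; rewrite /= ?row_mxKl ?row_mxKr. Qed.

Section chart.
Variable i : chart M.
Local Notation G1 y := (g1 i.1 (cinv i.1 (lsubmx y))).
Local Notation G2 y := (g2 i.2 (cinv i.2 (rsubmx y))).
Local Notation F1 y := (f1 (cinv i.1 (lsubmx y))).
Local Notation F2 y := (f2 (cinv i.2 (rsubmx y))).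
Local Notation grad1 y := (grad g1 f1 i.1 (cinv i.1 (lsubmx y))).
Local Notation grad2 y := (grad g2 f2 i.2 (cinv i.2 (rsubmx y))).
Local Notation df1 y v := (inner (G1 y) (grad1 y) (lsubmx v)).
Local Notation df2 y v := (inner (G2 y) (grad2 y) (rsubmx v)).
Local Notation cov1 y u v := (cov D1 i.1 (lsubmx y) (lsubmx u) (lsubmx v)).
Local Notation cov2 y u v := (cov D2 i.2 (rsubmx y) (rsubmx u) (rsubmx v)).

(** [df1] appears as the pairing with [grad1] so that parallelism can enter through
    [derive_inner_grad]; squares are spelled as products for the product rule. *)
Lemma warped_inner y v w : cod i y ->
  inner (h i (cinv i y)) v w =
  inner (G1 y) (lsubmx v) (lsubmx w)
  + c * c * (F2 y * F2 y * (df1 y v * df1 y w))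
  + F1 y * F1 y * inner (G2 y) (rsubmx v) (rsubmx w).
Proof.
move=> iy; have [ip _] := cod_dom iy; have [ip1 _] := ip.
rewrite warped_metricE // inner_block inner_addM !inner_scaleM inner_rank1 /=.
by rewrite !(grad_inner riem1) // !expr2; ring.
Qed.

Lemma derive_warped_inner x u v w : cod i x ->
  'D_u (fun y => inner (h i (cinv i y)) v w) x =
  inner (G1 x) (cov1 x u v) (lsubmx w) + inner (G1 x) (lsubmx v) (cov1 x u w)
  + c ^+ 2 * (2 * F2 x * df2 x u * df1 x v * df1 x w
    + F2 x ^+ 2 * (inner (G1 x) (grad1 x) (cov1 x u v) * df1 x w
                 + df1 x v * inner (G1 x) (grad1 x) (cov1 x u w)))
  + 2 * F1 x * df1 x u * inner (G2 x) (rsubmx v) (rsubmx w)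
  + F1 x ^+ 2 * (inner (G2 x) (cov2 x u v) (rsubmx w) + inner (G2 x) (rsubmx v) (cov2 x u w)).
Proof.
move=> ix; have [ix1 ix2] := cod_prod ix.
have hE : \forall y \near x, inner (h i (cinv i y)) v w =
    inner (G1 y) (lsubmx v) (lsubmx w)
    + c * c * (F2 y * F2 y * (df1 y v * df1 y w))
    + F1 y * F1 y * inner (G2 y) (rsubmx v) (rsubmx w).
  by apply: filterS (cod_nbhs ix) => y; exact: warped_inner.
rewrite (near_eq_derive _ hE).
have cd1 (w1 : 'rV[R]_n1) : differentiable (cst w1 : 'rV[R]_n1 -> 'rV[R]_n1) (lsubmx x).
  exact: differentiable_cst.
have cd2 (w2 : 'rV[R]_n2) : differentiable (cst w2 : 'rV[R]_n2 -> 'rV[R]_n2) (rsubmx x).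
  exact: differentiable_cst.
have dG1 := is_derive_lsubmx u (differentiable_inner (differentiable_metric riem1 ix1)
  (cd1 (lsubmx v)) (cd1 (lsubmx w))).
rewrite /= (derive_metric_cst lc1) // in dG1.
have dG2 := is_derive_rsubmx u (differentiable_inner (differentiable_metric riem2 ix2)
  (cd2 (rsubmx v)) (cd2 (rsubmx w))).
rewrite /= (derive_metric_cst lc2) // in dG2.
have dF1 := is_derive_lsubmx u (differentiable_fun smf1 ix1).
rewrite /= -(inner_grad riem1 smf1) // in dF1.
have dF2 := is_derive_rsubmx u (differentiable_fun smf2 ix2).
rewrite /= -(inner_grad riem2 smf2) // in dF2.
have ddf1 (z : 'rV[R]_(n1 + n2)) := is_derive_lsubmx u
  (differentiable_inner (differentiable_metric riem1 ix1)
  (differentiable_grad riem1 smf1 ix1) (cd1 (lsubmx z))).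
have ddf1v := ddf1 v; have ddf1w := ddf1 w.
rewrite /= (derive_inner_grad riem1 lc1 smf1 par) // in ddf1v.
rewrite /= (derive_inner_grad riem1 lc1 smf1 par) // in ddf1w.
apply: (@derive_val _ _ _ _ _ _ _ _).
apply: is_derive_eq; rewrite /GRing.scale /=; ring.
Qed.

Local Notation scale y := (1 + (c * F2 y) ^+ 2 * inner (G1 y) (grad1 y) (grad1 y))^-1.

Lemma scale_den_gt0 x : cod i x ->
  0 < 1 + (c * F2 x) ^+ 2 * inner (G1 x) (grad1 x) (grad1 x).
Proof.
move=> ix; have [ip1 _] := cod_dom (cod_prod ix).1.
by rewrite ltr_wpDr // mulr_ge0 ?sqr_ge0 ?inner_ge0.
Qed.

(** The three terms of [h(z, z)] are nonnegative, and as [f1 > 0] the first and the last vanish only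
    if both blocks of [z] do. *)
Lemma warped_inner_nondegenerate x u v : cod i x ->
  (forall w, inner (h i (cinv i x)) u w = inner (h i (cinv i x)) v w) -> u = v.
Proof.
move=> ix uv; apply/eqP; rewrite -subr_eq0; apply/eqP; set z := u - v.
have : inner (h i (cinv i x)) z z = 0 by rewrite innerDl innerNl uv subrr.
have [[ip1 _] [ip2 _]] := (cod_dom (cod_prod ix).1, cod_dom (cod_prod ix).2).
rewrite warped_inner // => /eqP.
have z1 := inner_ge0 (lsubmx z) riem1 ip1; have z2 := inner_ge0 (rsubmx z) riem2 ip2.
have F1_gt0 := f1_gt0 (cinv i.1 (lsubmx x)).
rewrite -!expr2; set q := c ^+ 2 * _.
have q0 : 0 <= q := mulr_ge0 (sqr_ge0 _) (mulr_ge0 (sqr_ge0 _) (sqr_ge0 _)).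
rewrite (paddr_eq0 (addr_ge0 z1 q0) (mulr_ge0 (sqr_ge0 _) z2)) (paddr_eq0 z1 q0)
  [X in _ && X]mulf_eq0 sqrf_eq0 (gt_eqF F1_gt0) /= (inner_eq0 _ riem1) // (inner_eq0 _ riem2) //.
by move=> /andP[/andP[/eqP z10 _] /eqP z20]; rewrite -[z]hsubmxK z10 z20 row_mx0.
Qed.

Variables (D : connection M) (lcD : levi_civita h D).

(** In the Koszul formula the horizontal terms in [w] are the slice metric paired with [cov1], plus
    multiples of [df1 x w]; the slice metric represents [df1] by [scale x *: grad1 x]. The vertical
    terms only have to be divided by [(F1 x)^2]. *)
Lemma cov_warped x u v : cod i x ->
  cov D i x u v = row_mx
    (cov1 x u v +
      ((c ^+ 2 * F2 x * (df2 x u * df1 x v + df2 x v * df1 x u)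
        - F1 x * inner (G2 x) (rsubmx u) (rsubmx v)) * scale x) *: grad1 x)
    (cov2 x u v + ((F1 x)^-1 * df1 x u) *: rsubmx v + ((F1 x)^-1 * df1 x v) *: rsubmx u
      - ((F1 x) ^- 2 * c ^+ 2 * F2 x * df1 x u * df1 x v) *: grad2 x).
Proof.
move=> ix; have [ix1 ix2] := cod_prod ix.
apply: (warped_inner_nondegenerate ix) => w.
have hT a b : inner (h i (cinv i x)) a b = inner (h i (cinv i x)) b a.
  rewrite !warped_inner //; congr (_ + _ * (_ * _) + _ * _); last 1 first.
  - by rewrite innerC ?(metric_sym riem2).
  - by rewrite innerC ?(metric_sym riem1).
  - exact: mulrC.
have two0 : (2 : R) != 0 by rewrite pnatr_eq0.
apply: (mulfI two0); rewrite (koszul lcD) //.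
rewrite !derive_warped_inner // warped_inner // !row_mxKl !row_mxKr.
rewrite !(innerDl, innerNl, innerZl, innerDr, innerZr).
rewrite (covC lc1 (lsubmx w) (lsubmx u)) // (covC lc1 (lsubmx w) (lsubmx v)) //.
rewrite (covC lc1 (lsubmx v) (lsubmx u)) //.
rewrite (covC lc2 (rsubmx w) (rsubmx u)) // (covC lc2 (rsubmx w) (rsubmx v)) //.
rewrite (covC lc2 (rsubmx v) (rsubmx u)) //.
have s1 := metric_sym riem1 ix1; have s2 := metric_sym riem2 ix2.
rewrite (innerC (lsubmx v) (cov1 x u w) s1) (innerC (lsubmx u) (cov1 x v w) s1).
rewrite (innerC (rsubmx v) (cov2 x u w) s2) (innerC (rsubmx u) (cov2 x v w) s2).
have e0 := lt0r_neq0 (scale_den_gt0 ix).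
have F10 := lt0r_neq0 (f1_gt0 (cinv i.1 (lsubmx x))).
by field; rewrite F10 e0.
Qed.

End chart.
End warped_connection.

(** * Gauss and Codazzi equations of the two families of slices *)

Section warped_curvature.
Variables (R : realType) (n1 n2 : nat) (M1 : manifold R n1) (M2 : manifold R n2).
Variables (g1 : tensor2 M1) (g2 : tensor2 M2) (D1 : connection M1) (D2 : connection M2).
Variables (c : R) (f1 : M1 -> R) (f2 : M2 -> R).
Hypotheses (riem1 : riemannian g1) (riem2 : riemannian g2).
Hypotheses (lc1 : levi_civita g1 D1) (lc2 : levi_civita g2 D2).
Hypotheses (smf1 : smooth_fun f1) (smf2 : smooth_fun f2) (f1_gt0 : forall p, 0 < f1 p).
Hypothesis par : parallel D1 (grad g1 f1).
Let M := prod_manifold M1 M2.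
Variable D : connection M.
Hypothesis lcD : levi_civita (warped_metric g1 g2 c f1 f2) D.
Hypothesis flatD : forall i p, dom i p -> forall u v w, riemann D i p u v w = 0.

Variables (i1 : chart M1) (i2 : chart M2).
Let i : chart M := (i1, i2).
Local Notation G1 y := (g1 i1 (cinv i1 y)).
Local Notation G2 y := (g2 i2 (cinv i2 y)).
Local Notation F1 y := (f1 (cinv i1 y)).
Local Notation F2 y := (f2 (cinv i2 y)).
Local Notation grad1 y := (grad g1 f1 i1 (cinv i1 y)).
Local Notation grad2 y := (grad g2 f2 i2 (cinv i2 y)).
Local Notation scale y1 y2 := (1 + (c * F2 y2) ^+ 2 * inner (G1 y1) (grad1 y1) (grad1 y1))^-1.

Local Notation df1 y v := (inner (G1 y) (grad1 y) v).
Local Notation df2 y v := (inner (G2 y) (grad2 y) v).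

Lemma cov_row_mx y1 y2 u1 u2 v1 v2 : cod i1 y1 -> cod i2 y2 ->
  cov D i (row_mx y1 y2) (row_mx u1 u2) (row_mx v1 v2) = row_mx
    (cov D1 i1 y1 u1 v1 +
      ((c ^+ 2 * F2 y2 * (df2 y2 u2 * df1 y1 v1 + df2 y2 v2 * df1 y1 u1)
        - F1 y1 * inner (G2 y2) u2 v2) * scale y1 y2) *: grad1 y1)
    (cov D2 i2 y2 u2 v2 + ((F1 y1)^-1 * df1 y1 u1) *: v2 + ((F1 y1)^-1 * df1 y1 v1) *: u2
      - ((F1 y1) ^- 2 * c ^+ 2 * F2 y2 * df1 y1 u1 * df1 y1 v1) *: grad2 y2).
Proof.
move=> iy1 iy2; have iy : cod i (row_mx y1 y2) by exact: cod_row_mx.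
by rewrite (cov_warped riem1 riem2 lc1 lc2 smf1 smf2 f1_gt0 par lcD) // !row_mxKl !row_mxKr.
Qed.

(** The vertical block is the second fundamental form of the slice: half the fibre gradient of
    [(c f2)^2], divided by the factor [f1^2] of the fibre metric. *)
Lemma cov_horizontal y1 y2 u v : cod i1 y1 -> cod i2 y2 ->
  cov D i (row_mx y1 y2) (row_mx u 0) (row_mx v 0) =
  row_mx (cov D1 i1 y1 u v)
    (- ((F1 y1) ^- 2 * c ^+ 2 * F2 y2 * inner (G1 y1) (grad1 y1) u * inner (G1 y1) (grad1 y1) v)
       *: grad2 y2).
Proof.
move=> iy1 iy2; rewrite cov_row_mx //.
rewrite !inner0r !scaler0 cov0l !mul0r !addr0 !mulr0 subrr mul0r.
by rewrite scale0r addr0 add0r scaleNr.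
Qed.

(** The fibres are totally umbilical: the horizontal block is [g2] times a fixed multiple of
    [grad1], and the induced metric [f1^2 g2] has the connection of [g2]. *)
Lemma cov_vertical y1 y2 u v : cod i1 y1 -> cod i2 y2 ->
  cov D i (row_mx y1 y2) (row_mx 0 u) (row_mx 0 v) =
  row_mx (- (F1 y1 * inner (G2 y2) u v * scale y1 y2) *: grad1 y1) (cov D2 i2 y2 u v).
Proof.
move=> iy1 iy2; rewrite cov_row_mx //.
rewrite !inner0r cov0l !(mulr0, mul0r) !addr0 !scale0r !(mulr0, add0r).
by rewrite subr0 !addr0 mulNr.
Qed.

Variables (p1 : M1) (p2 : M2).
Hypotheses (ip1 : dom i1 p1) (ip2 : dom i2 p2).
Let x1 := coords i1 p1.
Let x2 := coords i2 p2.
Let cx1 : cod i1 x1. Proof. by exists p1. Qed.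
Let cx2 : cod i2 x2. Proof. by exists p2. Qed.
Let ix : cod i (row_mx x1 x2). Proof. exact: cod_row_mx. Qed.

(** The second fundamental form of [M1 x {p2}] is proportional to [df1 (x) df1], so it
    cancels out of the Gauss equation. *)
Lemma riemann_base_eq0 u v w : riemann D1 i1 p1 u v w = 0.
Proof.
have R0 := flatD (i := i) (p := (p1, p2)) (conj ip1 ip2) (row_mx u 0) (row_mx v 0) (row_mx w 0).
have R1 := f_equal lsubmx R0; rewrite [lsubmx 0]linear0 in R1.
rewrite riemannE [coords _ _](_ : _ = row_mx x1 x2) // in R1.
have dcov a b : lsubmx ('D_(row_mx a 0)
      (fun y => cov D i y (row_mx b 0) (row_mx w 0)) (row_mx x1 x2)) =
    'D_a (fun y => cov D1 i1 y b w) x1.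
  rewrite derive_rowl row_mxKl row_mxKr.
  pose K y := row_mx (cov D1 i1 y b w)
    (- ((F1 y) ^- 2 * c ^+ 2 * F2 x2 * inner (G1 y) (grad1 y) b * inner (G1 y) (grad1 y) w)
       *: grad2 x2).
  have E : \forall y \near x1, cov D i (row_mx y x2) (row_mx b 0) (row_mx w 0) = K y.
    by apply: filterS (cod_nbhs cx1) => y iy; exact: cov_horizontal.
  rewrite (near_eq_derive _ E).
  have d1 : is_derive x1 a (fun y => cov D1 i1 y b w) ('D_a (fun y => cov D1 i1 y b w) x1).
    by apply/derivableP/diff_derivable; exact: (differentiable_cov riem1 lc1).
  have dg z : differentiable (fun y => inner (G1 y) (grad1 y) z) x1.
    apply: differentiable_inner; [exact: differentiable_metric| |exact: differentiable_cst].
    exact: differentiable_grad.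
  (* [lsubmx] will discard this block, but differentiating the row requires it to be derivable. *)
  have d2 : derivable (fun y => - ((F1 y) ^- 2 * c ^+ 2 * F2 x2 *
      inner (G1 y) (grad1 y) b * inner (G1 y) (grad1 y) w) *: grad2 x2) x1 a.
    apply: diff_derivable; apply: differentiableZl; apply: differentiableN.
    apply: differentiableM; last exact: dg.
    apply: differentiableM; last exact: dg.
    apply: differentiableM; last exact: differentiable_cst.
    apply: differentiableM; last exact: differentiable_cst.
    apply: differentiableV; last by rewrite sqrf_eq0 lt0r_neq0.
    by under eq_fun do rewrite expr2; apply: differentiableM; exact: differentiable_fun.
  by rewrite (@derive_val _ _ _ _ _ _ _ (is_derive_row_mx d1 (derivableP d2))) row_mxKl.
(* The vertical part of the inner derivative, fed back through the mixed term of [cov_row_mx],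
   yields a multiple of [grad1 x1] symmetric in [a] and [b]. *)
have covcov a b : lsubmx (cov D i (row_mx x1 x2) (row_mx a 0)
      (cov D i (row_mx x1 x2) (row_mx b 0) (row_mx w 0))) =
    cov D1 i1 x1 a (cov D1 i1 x1 b w) + (- (c ^+ 2 * F2 x2 * (F1 x1) ^- 2 * c ^+ 2 * F2 x2 *
      df2 x2 (grad2 x2) * scale x1 x2 * df1 x1 w) * df1 x1 a * df1 x1 b) *: grad1 x1.
  rewrite cov_horizontal // cov_row_mx // row_mxKl; congr (_ + _ *: _).
  by rewrite inner0r inner0l innerZr; ring.
rewrite linearB !linearD /= !dcov !covcov (mulrAC _ (df1 x1 v) (df1 x1 u)) in R1.
have cancel (V : zmodType) (a b d e t : V) : a + (b + t) + (- d - (e + t)) = a + b - (d + e).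
  by rewrite -opprD !addrA opprD addrACA subrr addr0.
by rewrite riemannE -/x1 -[RHS]R1 cancel.
Qed.

(** The Codazzi and Gauss equations of [{p1} x M2]. *)
Lemma riemann_vertical u v w : let b1 := inner (G1 x1) (grad1 x1) (grad1 x1) in
  (c ^+ 2 * F1 x1 * F2 x2 * b1 * scale x1 x2 ^+ 2 *
    (inner (G2 x2) v w * df2 x2 u
     - inner (G2 x2) u w * df2 x2 v)) *: grad1 x1 = 0 /\
  riemann D2 i2 p2 u v w =
    (b1 * scale x1 x2) *: (inner (G2 x2) v w *: u - inner (G2 x2) u w *: v).
Proof.
move=> b1.
have R0 := flatD (i := i) (p := (p1, p2)) (conj ip1 ip2) (row_mx 0 u) (row_mx 0 v) (row_mx 0 w).
rewrite riemannE [coords _ _](_ : _ = row_mx x1 x2) // in R0.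
have e0 : 1 + (c * F2 x2) ^+ 2 * b1 != 0.
  apply: lt0r_neq0; have := scale_den_gt0 c f1 f2 riem1 ix.
  by rewrite row_mxKl row_mxKr.
(* The last horizontal term is the derivative of [scale], which varies along the fibre through
   [f2]. *)
have dcov a b : 'D_(row_mx 0 a) (fun y => cov D i y (row_mx 0 b) (row_mx 0 w)) (row_mx x1 x2) =
    row_mx (- (F1 x1 * ((inner (G2 x2) (cov D2 i2 x2 a b) w + inner (G2 x2) b (cov D2 i2 x2 a w))
        * scale x1 x2 - inner (G2 x2) b w * (scale x1 x2 ^+ 2 *
          (2 * c ^+ 2 * F2 x2 * df2 x2 a * b1)))) *: grad1 x1)
    ('D_a (fun y => cov D2 i2 y b w) x2).
  rewrite derive_rowr row_mxKl row_mxKr.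
  have E : \forall y \near x2, cov D i (row_mx x1 y) (row_mx 0 b) (row_mx 0 w) =
      row_mx (- (F1 x1 * inner (G2 y) b w * scale x1 y) *: grad1 x1) (cov D2 i2 y b w).
    by apply: filterS (cod_nbhs cx2) => y iy; exact: cov_vertical.
  rewrite (near_eq_derive _ E).
  have d2 : is_derive x2 a (fun y => cov D2 i2 y b w) ('D_a (fun y => cov D2 i2 y b w) x2).
    by apply/derivableP/diff_derivable; exact: (differentiable_cov riem2 lc2).
  have dF2 := derivableP (diff_derivable (v := a) (differentiable_fun smf2 cx2)).
  rewrite -(inner_grad riem2 smf2) // in dF2.
  have dG2 : is_derive x2 a (fun y => inner (G2 y) b w)
      (inner (G2 x2) (cov D2 i2 x2 a b) w + inner (G2 x2) b (cov D2 i2 x2 a w)).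
    rewrite -(derive_metric_cst lc2) //; apply/derivableP/diff_derivable.
    by apply: differentiable_inner;
      [exact: differentiable_metric|exact: differentiable_cst|exact: differentiable_cst].
  have ds : is_derive x2 a (fun y => scale x1 y) (- (scale x1 x2 ^+ 2 *
      (2 * c ^+ 2 * F2 x2 * df2 x2 a * b1))).
    apply: is_derive_inv => //; under eq_fun do rewrite expr2.
    by apply: is_derive_eq; rewrite /GRing.scale /= -/b1; ring.
  have dK : is_derive x2 a (fun y => - (F1 x1 * inner (G2 y) b w * scale x1 y))
      (- (F1 x1 * ((inner (G2 x2) (cov D2 i2 x2 a b) w + inner (G2 x2) b (cov D2 i2 x2 a w))
        * scale x1 x2 - inner (G2 x2) b w * (scale x1 x2 ^+ 2 *
          (2 * c ^+ 2 * F2 x2 * df2 x2 a * b1))))).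
    by apply: is_derive_eq; rewrite /GRing.scale /=; ring.
  have d1 := is_derive_scaler (grad1 x1) dK.
  exact: (@derive_val _ _ _ _ _ _ _ (is_derive_row_mx d1 d2)).
(* Its horizontal term in [df2 x2 a] cancels half of the derivative of [scale], so the Codazzi
   coefficient survives. In the vertical block [(F1 x1)^-1] meets the [F1 x1] of the second
   fundamental form, leaving [b1 * scale x1 x2]. *)
have covcov a b : cov D i (row_mx x1 x2) (row_mx 0 a)
      (cov D i (row_mx x1 x2) (row_mx 0 b) (row_mx 0 w)) =
    row_mx (- ((c ^+ 2 * F2 x2 * df2 x2 a * F1 x1 * inner (G2 x2) b w * scale x1 x2 * b1
        + F1 x1 * inner (G2 x2) a (cov D2 i2 x2 b w)) * scale x1 x2) *: grad1 x1)
      (cov D2 i2 x2 a (cov D2 i2 x2 b w) - (inner (G2 x2) b w * (b1 * scale x1 x2)) *: a).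
  rewrite cov_vertical // cov_row_mx // inner0r cov0l add0r; congr row_mx.
    by rewrite innerZr -/b1; congr (_ *: _); ring.
  rewrite !(mulr0, mul0r) !scale0r subr0 addr0 innerZr -/b1 -[in RHS]scaleNr; congr (_ + _ *: _).
  by field; rewrite e0 lt0r_neq0.
rewrite !dcov !covcov !add_row_mx opp_row_mx add_row_mx -(row_mx0 R 1 n1 n2) in R0.
have [Ra Rb] := eq_row_mx R0; split.
  move: Ra; rewrite -!scalerDl -scalerBl => Ra; rewrite -[RHS]Ra; congr (_ *: _).
  by rewrite (covC lc2 v u) // -/b1; ring.
have move_sub (V : zmodType) (p q r s t z : V) :
    p + (q - r) - (s + (t - z)) = 0 -> p + q - (s + t) = r - z.
  have E A B : A - r - (B - z) = A - B - (r - z).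
    by rewrite !opprB addrACA [RHS]addrACA [- r - B]addrC.
  by rewrite !addrA E => /eqP; rewrite subr_eq0 => /eqP.
by rewrite riemannE -/x2 (move_sub _ _ _ _ _ _ _ Rb) scalerBr !scalerA !(mulrC (b1 / _)).
Qed.

End warped_curvature.

(** * Sectional curvature and the conclusion *)

Lemma spans_plane_indep (R : realType) n (u v : 'rV[R]_n) a b :
  spans_plane u v -> a *: u + b *: v = 0 -> a = 0 /\ b = 0.
Proof.
move=> uv ab0; have : row_mx a%:M b%:M *m col_mx u v = 0 *m col_mx u v.
  by rewrite mul_row_col !mul_scalar_mx mul0mx.
move=> /(row_free_inj uv) /rowP E; split.
  by have := E (lshift 1 0); rewrite row_mxEl !mxE.
by have := E (rshift 1 0); rewrite row_mxEr !mxE.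
Qed.

Lemma gram_gt0 (R : realType) n (M : manifold R n) (g : tensor2 M) i p u v :
  riemannian g -> dom i p -> spans_plane u v ->
  0 < inner (g i p) u u * inner (g i p) v v - inner (g i p) u v ^+ 2.
Proof.
move=> rg ip uv; have [_ sg pos _] := rg; set G := g i p.
have v0 : v != 0.
  apply/eqP => v0; have [|_ /eqP] := @spans_plane_indep _ _ u v 0 1 uv.
    by rewrite scale0r scale1r v0 addr0.
  by rewrite oner_eq0.
have vv : 0 < inner G v v by exact: pos.
(* [z] is [inner G v v] times the component of [u] orthogonal to [v], and its squared norm is
   [inner G v v] times the Gram determinant. *)
pose z := inner G v v *: u + (- inner G u v) *: v.
have z0 : z != 0.
  by apply/eqP => /(spans_plane_indep uv) [/eqP]; rewrite gt_eqF.
have := pos _ _ ip _ z0; rewrite -/G /z !(innerDl, innerDr, innerZl, innerZr).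
rewrite (innerC v u) ?sg // => zz; rewrite -(pmulr_rgt0 _ vv).
by apply: (lt_le_trans zz); rewrite le_eqVlt; apply/orP; left; apply/eqP; ring.
Qed.

Theorem corollary4 (R : realType) (n1 n2 : nat)
    (M1 : manifold R n1) (M2 : manifold R n2)
    (g1 : tensor2 M1) (g2 : tensor2 M2)
    (nabla1 : connection M1) (nabla2 : connection M2)
    (c : R) (f1 : M1 -> R) (f2 : M2 -> R) :
  connected [set: M1] -> connected [set: M2] ->
  riemannian g1 -> riemannian g2 ->
  levi_civita g1 nabla1 -> levi_civita g2 nabla2 ->
  smooth_fun f1 -> (forall p, 0 < f1 p) ->
  smooth_fun f2 -> (forall q, 0 < f2 q) ->
  parallel nabla1 (grad g1 f1) ->
  flat (warped_metric g1 g2 c f1 f2) ->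
  flat g1 /\
  exists b1 : R,
    (forall i p, dom i p ->
       inner (g1 i p) (grad g1 f1 i p) (grad g1 f1 i p) = b1) /\
    exists k : R, forall j q, dom j q -> forall u v, spans_plane u v ->
      sectional g2 nabla2 j q u v = k /\
      k = b1 / (1 + (c * f2 q) ^+ 2 * b1).
Proof.
move=> conn1 conn2 riem1 riem2 lc1 lc2 smf1 f1_gt0 smf2 f2_gt0 par [D lcD flatD].
have [p0 _] := man_nonempty M1; have [q0 _] := man_nonempty M2.
have [i0 ip0] := man_cover p0; have [j0 jq0] := man_cover q0.
split.
  exists nabla1 => // i p ip u v w.
  exact: (riemann_base_eq0 riem1 riem2 lc1 lc2 smf1 smf2 f1_gt0 par lcD flatD ip jq0).
have [b1 b1E] := grad_norm_cst riem1 lc1 smf1 par conn1.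
exists b1; split=> //; exists (b1 / (1 + (c * f2 q0) ^+ 2 * b1)) => j q jq u v uv.
have vert j' q' := riemann_vertical riem1 riem2 lc1 lc2 smf1 smf2 f1_gt0 par lcD flatD ip0
  (i2 := j') (p2 := q').
have b1_ge0 : 0 <= b1 by rewrite -(b1E _ _ ip0) inner_ge0.
have den q' : 1 + (c * f2 q') ^+ 2 * b1 != 0.
  by rewrite lt0r_neq0 // ltr_wpDr // mulr_ge0 ?sqr_ge0.
(* If [c] or [b1] is zero, the formula no longer contains [f2]. Otherwise the Codazzi equation makes
   [f2] locally constant, and [M2] is connected. *)
have kE : b1 / (1 + (c * f2 q0) ^+ 2 * b1) = b1 / (1 + (c * f2 q) ^+ 2 * b1).
  have [->|c0] := eqVneq c 0; first by rewrite !mul0r.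
  have [->|b0] := eqVneq b1 0; first by rewrite !mul0r.
  suff -> : f2 q0 = f2 q by [].
  apply: (connected_near_cst conn2) => {jq q j} q.
  have [j jq] := man_cover q.
  have df2 : \forall y \near coords j q, (f2 \o cinv j) y = (f2 \o cinv j) (coords j q).
    apply: derive0_near_cst.
    have : \forall y \near coords j q, cod j y by apply: cod_nbhs; exists q.
    apply: filterS => _ [q' jq' <-]; set y := coords j q'.
    have jy : cod j y by exists q'.
    split=> [|w]; first exact: differentiable_fun.
    have dE z : 'D_z (f2 \o cinv j) y = inner (g2 j q') (grad g2 f2 j q') z.
      by rewrite -(inner_grad riem2 smf2) // /y coordsK.
    rewrite dE; set b := inner _ _.
    have lin z z' : b z *: z' = b z' *: z.
      (* Codazzi says that the difference is orthogonal to every vector. *)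
      have [_ _ pos _] := riem2; apply/eqP; rewrite -subr_eq0; apply: contraT.
      move=> /(pos _ _ jq'); set d := _ - _ => dd.
      have [+ _] := vert j q' jq' z z' d.
      rewrite !coordsK // b1E // => /eqP; rewrite scaler_eq0 => /orP[|/eqP g0]; last first.
        by move: (b1E _ _ ip0) b0; rewrite g0 inner0l => <-; rewrite eqxx.
      rewrite !mulf_eq0 invr_eq0 (negPf (den q')) (negPf c0) (negPf b0).
      rewrite (gt_eqF (f1_gt0 p0)) (gt_eqF (f2_gt0 q')) /= subr_eq0 => /eqP E.
      by move: dd; rewrite {1}/d innerDl innerNl !innerZl mulrC E mulrC subrr ltxx.
    (* Here [dim M2 >= 2] enters. The given [u], [v] span a plane at another point, but as
       independent row vectors they serve in every chart: [lin u v] gives [b u = 0], and then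
       [lin u w] gives [b w = 0]. *)
    have bu : b u = 0.
      have [|_ /eqP] := spans_plane_indep (a := b v) (b := - b u) uv.
        by rewrite scaleNr (lin v) subrr.
      by rewrite oppr_eq0 => /eqP.
    have u0 : u != 0.
      apply/eqP => u0; have [|/eqP] := spans_plane_indep (a := 1) (b := 0) uv.
        by rewrite scale0r scale1r u0 addr0.
      by rewrite oner_eq0.
    by have /eqP := lin u w; rewrite bu scale0r eq_sym scaler_eq0 (negPf u0) orbF => /eqP.
  by apply: filterS (dom_nbhs jq df2) => q' [jq'] /=; rewrite !coordsK.
split=> //; rewrite kE /sectional.
have [_ ->] := vert j q jq u v v; rewrite !coordsK // b1E //.
rewrite innerZl innerDl innerNl !innerZl.
have [_ sg _ _] := riem2; rewrite (innerC v u) ?sg // -expr2.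
by rewrite [inner _ v v * _]mulrC mulfK // lt0r_neq0 // gram_gt0.
Qed.
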